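(* Let $(\epsilon_n)_{n\ge1}$ be a decreasing sequence with $\epsilon_n>0$ for all $n$ and $\sum_{n=1}^\infty\epsilon_n=\infty$. Let $\mathcal R$ be the set of ergodic $\tau\in\mathcal M$ such that for $m$-a.e. $y\in[0,1]$ and for every $N\ge1$, $$m\Big(\bigcup_{n=N}^\infty\tau^{-n}\big(B_{\epsilon_n}(y)\big)\Big)=1,$$ i.e. $[0,1]=\bigcup_{n=N}^\infty\tau^{-n}(B_{\epsilon_n}(y))$ up to a null set. Then $\mathcal R$ is a dense $G_\delta$ subset of $\mathcal M$.
   Context: $[0,1]$ is identified with the circle $\mathbb R/\mathbb Z$ (addition modulo one), with Lebesgue measure $m$ and the distance modulo one. For $y\in[0,1]$ and $r>0$, $B_r(y)=[y-r,y+r]$ modulo one. $\mathcal M$ denotes the group of invertible measure-preserving transformations of $([0,1],m)$ (modulo null sets), equipped with the weak topology: $\tau_j\to\tau$ iff $m(\tau_j(A)\,\triangle\,\tau(A))\to0$ for every measurable $A$; this is a Polish (completely metrizable) topology. *)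

(* Defs.v *)
From HB Require Import structures.
From mathcomp Require Import all_boot all_order all_algebra.
From mathcomp Require Import all_classical all_reals all_analysis.
Set Implicit Arguments. Unset Strict Implicit. Unset Printing Implicit Defensive.
Import Order.TTheory GRing.Theory Num.Theory.
Import numFieldNormedType.Exports.
Local Open Scope classical_set_scope.
Local Open Scope ring_scope.

Section Defs.
Variable R : realType.
Local Notation m := (@lebesgue_measure R).

(* The circle R/Z is represented by the fundamental domain [0,1). *)
Definition I01 : set R := `[0, 1[%classic.

Definition cball (y r : R) : set R :=
  [set x | I01 x /\ exists k : int, `|x - y - k%:~R| <= r].

Definition symdiff (A B : set R) : set R := (A `\` B) `|` (B `\` A).

(* Representatives of elements of the group M: measurable bijections of
   [0,1) onto itself preserving Lebesgue measure (images and preimages). *)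
Definition inM (tau : R -> R) : Prop :=
  set_bij I01 I01 tau /\
  forall A : set R, measurable A -> A `<=` I01 ->
    measurable (tau @` A) /\ m (tau @` A) = m A /\
    measurable (tau @^-1` A `&` I01) /\ m (tau @^-1` A `&` I01) = m A.

Definition ergodic (tau : R -> R) : Prop :=
  forall A : set R, measurable A -> A `<=` I01 ->
    tau @^-1` A `&` I01 = A -> (m A = 0%E \/ m A = 1%E).

(* Basic open sets of the weak topology: open subsets of M
   (represented as saturated sets of representatives). *)
Definition weak_open (U : set (R -> R)) : Prop :=
  U `<=` inM /\
  forall tau, U tau ->
    exists (k : nat) (As : nat -> set R) (e : R),
      (forall i, (i < k)%N -> measurable (As i) /\ As i `<=` I01) /\ 0 < e /\
      forall sigma, inM sigma ->
        (forall i, (i < k)%N ->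
           (m (symdiff (sigma @` As i) (tau @` As i)) < e%:E)%E) ->
        U sigma.

Definition weak_Gdelta (S : set (R -> R)) : Prop :=
  exists U : nat -> set (R -> R),
    (forall n, weak_open (U n)) /\ S = \bigcap_n U n.

Definition weak_dense (S : set (R -> R)) : Prop :=
  forall U, weak_open U -> U !=set0 -> (U `&` S) !=set0.

Definition shrinking_target_full (eps : nat -> R) (tau : R -> R) : Prop :=
  exists Z : set R, measurable Z /\ m Z = 0%E /\
    forall y, `[0, 1]%classic y -> ~ Z y ->
      forall N : nat, (1 <= N)%N ->
        m (\bigcup_(n in [set n | (N <= n)%N])
              ((iter n tau) @^-1` (cball y (eps n)) `&` I01)) = 1%E.

Definition Rset (eps : nat -> R) : set (R -> R) :=
  [set tau | inM tau /\ ergodic tau /\ shrinking_target_full eps tau].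

End Defs.

(* Main.v *)
Require Import Defs.
From HB Require Import structures.
From mathcomp Require Import all_boot all_order all_algebra all_fingroup.
From mathcomp Require Import all_classical all_reals all_analysis measurable_realfun.
From mathcomp Require Import ring lra zify.
Set Implicit Arguments.
Unset Strict Implicit.
Unset Printing Implicit Defensive.
Import Order.TTheory GRing.Theory Num.Theory.
Import numFieldNormedType.Exports.
Local Open Scope classical_set_scope.
Local Open Scope ring_scope.

(** Density.  The dyadic odometer adds 1 to the sequence of binary digits read
    as a 2-adic integer, so its [n]-th iterate moves [x] into the dyadic cell of
    rank [k] around [y] iff the rank-[k] addresses satisfy
    [address x + n = address y] modulo [2 ^ k].  For nondecreasing [k_n] with
    [\sum 2 ^ - k_n = +oo] the events "[T^n x] and [y] share a cell of rank
    [k_n]" have a counting function whose variance is at most its mean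
    (two of them either exclude each other or are nested along an arithmetic
    progression), so for every [y] almost every [x] is hit infinitely often.
    A permutation of the dyadic cells of rank [r] by translations maps cells of
    rank [>= r] to cells of the same rank, so conjugating the odometer by it
    keeps the target property.  These conjugates are weakly dense: any
    measure-preserving bijection is close to a permutation of dyadic cells,
    which transpositions turn into a cyclic one at small cost, and a cyclic
    permutation of the cells is conjugate to the action of the odometer.

    G_delta.  Ergodicity is equivalent to the following open conditions: for each
    dyadic set [A] of measure at least 1/2 and [e > 0], finitely many disjoint
    pieces [A_n] of [A] have images [tau^n A_n] covering the complement of [A]
    up to measure [e] (necessity is a greedy exhaustion).  The target property is
    a countable intersection of conditions on finitely many iterates, once balls
    are replaced by dyadic inner approximations and "almost every [y]" by "a set of
    centres of measure [> 1 - 1/q]". *)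

(** * Lebesgue measure on the unit interval *)

Section UnitMeasure.
Context {R : realType}.
Local Notation m := (@lebesgue_measure R).
Local Notation I01 := (@I01 R).

(** Real-valued and cut down to [I01]: estimates become goals for linear arithmetic, without
    finiteness or inclusion side conditions. *)
Definition mu (A : set R) : R := fine (m (A `&` I01)).

Lemma measurable_I01 : measurable I01. Proof. exact: measurable_itv. Qed.
Hint Resolve measurable_I01 : core.

Lemma m_I01 : m I01 = 1%E.
Proof. by rewrite /Defs.I01 lebesgue_measure_itv /= lte_fin ltr01 oppr0 adde0. Qed.

Lemma m_mu (A : set R) : measurable A -> m (A `&` I01) = (mu A)%:E.
Proof.
move=> mA; rewrite /mu fineK// ge0_fin_numE; last exact: measure_ge0.
apply: (@le_lt_trans _ _ (m I01)); last by rewrite m_I01 ltry.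
apply: le_measure; rewrite ?inE; [|exact: measurable_I01|by move=> x []].
exact: measurableI mA measurable_I01.
Qed.

Lemma m_muS (A : set R) : measurable A -> A `<=` I01 -> m A = (mu A)%:E.
Proof. by move=> mA AI; rewrite -m_mu// setIidl. Qed.

Lemma mu_ge0 (A : set R) : 0 <= mu A.
Proof. by rewrite /mu fine_ge0. Qed.

Lemma mu_mono (A B : set R) : measurable A -> measurable B -> A `&` I01 `<=` B ->
  mu A <= mu B.
Proof.
move=> mA mB AB; rewrite -lee_fin -!m_mu//.
apply: le_measure; rewrite ?inE.
- exact: measurableI mA measurable_I01.
- exact: measurableI mB measurable_I01.
- by move=> x [Ax Ix]; split=> //; apply: AB.
Qed.

Lemma muI_I01 (A : set R) : mu (A `&` I01) = mu A.
Proof. by rewrite /mu -setIA setIid. Qed.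

Lemma mu_I01 : mu I01 = 1.
Proof. by rewrite /mu setIid m_I01. Qed.

Lemma mu_le1 (A : set R) : measurable A -> mu A <= 1.
Proof.
by move=> mA; rewrite -mu_I01; apply: mu_mono.
Qed.

Lemma mu_set0 : mu set0 = 0.
Proof. by rewrite /mu set0I measure0. Qed.

Lemma muU (A B : set R) : measurable A -> measurable B -> A `&` B `&` I01 = set0 ->
  mu (A `|` B) = mu A + mu B.
Proof.
move=> mA mB AB0; apply: EFin_inj; rewrite EFinD -!m_mu//; last exact: measurableU.
rewrite setIUl measureU//.
- exact: measurableI mA measurable_I01.
- exact: measurableI mB measurable_I01.
- by rewrite setIACA setIid.
Qed.

Lemma muDI (A B : set R) : measurable A -> measurable B ->
  mu A = mu (A `&` B) + mu (A `\` B).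
Proof.
move=> mA mB; rewrite -muU.
- by congr mu; rewrite setUIDK.
- exact: measurableI.
- exact: measurableD.
- by apply/seteqP; split=> // x [[[_ Bx] [_ nBx]] _]; case: nBx.
Qed.

Lemma muU_le (A B C : set R) : measurable A -> measurable B -> measurable C ->
  A `&` I01 `<=` B `|` C -> mu A <= mu B + mu C.
Proof.
move=> mA mB mC ABC; rewrite (muDI mA mB); apply: lerD.
- by apply: mu_mono => //; [exact: measurableI|move=> x [[]]].
- apply: mu_mono => //; first exact: measurableD.
  by move=> x [[Ax nBx] Ix]; have [|] : (B `|` C) x by apply: ABC.
Qed.

Lemma mu_sum_le (n : nat) (F : nat -> set R) (A : set R) : measurable A ->
  (forall i, (i < n)%N -> measurable (F i)) ->
  (forall x, A x -> I01 x -> exists2 i, (i < n)%N & F i x) ->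
  mu A <= \sum_(i < n) mu (F i).
Proof.
elim: n A => [|n IH] A mA mF AF.
  rewrite big_ord0 -mu_set0; apply: mu_mono => // x [Ax Ix].
  by have [] := AF x Ax Ix.
rewrite big_ord_recr /= (muDI mA (mF n (ltnSn n))) [leLHS]addrC; apply: lerD.
- apply: IH => [|i ltin|x [Ax nFx] Ix].
  + by apply: measurableD => //; exact: mF.
  + by apply: mF; rewrite ltnS ltnW.
  + have [i] := AF x Ax Ix; rewrite ltnS leq_eqVlt => /predU1P[->//|ltin Fx].
    by exists i.
- apply: mu_mono; [|exact: mF|by move=> x [[]]].
  by apply: measurableI => //; exact: mF.
Qed.

(** Continuity from below, phrased so as to extract a finite stage; this is how full-measure
    statements become weakly open conditions. *)
Lemma mu_up (F : nat -> set R) c : (forall n, measurable (F n)) ->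
  (forall n, F n `<=` F n.+1) -> c < mu (\bigcup_n F n) -> exists n, c < mu (F n).
Proof.
move=> mF incF cF.
have mFI n : measurable (F n `&` I01) by exact: measurableI (mF n) measurable_I01.
have : (m \o (fun n => F n `&` I01)) @ \oo --> m (\bigcup_n (F n `&` I01)).
  apply: nondecreasing_cvg_mu => //; first exact: bigcupT_measurable.
  apply/nondecreasing_seqP => n; apply/subsetPset => x [Fx Ix].
  by split=> //; exact: incF.
rewrite -setI_bigcupl m_mu; last exact: bigcupT_measurable.
move=> /fine_cvgP[_] /(_ _ (lt_nbhsr cF)) [n _ /(_ n (leqnn n))] /= h.
by exists n.
Qed.

Lemma mu_down (F : nat -> set R) c : (forall n, measurable (F n)) ->
  (forall n, F n.+1 `<=` F n) -> mu (\bigcap_n F n) < c -> exists n, mu (F n) < c.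
Proof.
move=> mF decF cF.
have mC n : measurable (~` F n) by exact: measurableC.
have muC A : measurable A -> mu A = 1 - mu (~` A).
  move=> mA; rewrite -mu_I01 (muDI measurable_I01 mA).
  by rewrite setDE 2!(setIC I01) !muI_I01 addrK.
have mFc : measurable (\bigcap_n F n) by exact: bigcapT_measurable.
move: cF; rewrite muC// setC_bigcap => cF.
have [||n hn] := @mu_up (fun n => ~` F n) (1 - c) mC.
- by move=> n x nFx /decF.
- by lra.
- by exists n; rewrite muC//; lra.
Qed.

Lemma mu0_bigcup (F : nat -> set R) : (forall n, measurable (F n)) ->
  (forall n, mu (F n) = 0) -> mu (\bigcup_n F n) = 0.
Proof.
move=> mF F0; apply/eqP; rewrite eq_le mu_ge0 andbT leNgt; apply/negP => h.
have [n|||n] := @mu_up (fun n => \bigcup_(i in `I_n) F i) 0.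
- by apply: bigcup_measurable.
- by move=> n x [i /= ltin Fx]; exists i => //=; rewrite ltnS ltnW.
- suff -> : \bigcup_n \bigcup_(i in `I_n) F i = \bigcup_n F n by [].
  apply/seteqP; split=> [x [n _ [i _ Fx]]|x [i _ Fx]]; first by exists i.
  by exists i.+1 => //; exists i => /=.
apply/negP; rewrite -leNgt.
have -> : 0 = \sum_(i < n) mu (F i) by rewrite big1.
apply: mu_sum_le => //.
  by apply: bigcup_measurable.
Qed.

Lemma measurable_shift (c : R) (A : set R) : measurable A ->
  measurable ((fun x => x + c) @^-1` A).
Proof.
move=> mA; rewrite -[X in measurable X]setTI.
have : measurable_fun setT (fun x : R => x + c) by exact: measurable_funD.
exact.
Qed.

(** Uniqueness of Lebesgue measure: the pushforward by a translation agrees with it on the intervals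
    []a, b]]. *)
Lemma m_shift (c : R) (A : set R) : measurable A -> m ((fun x => x + c) @^-1` A) = m A.
Proof.
move=> mA.
have mf : measurable_fun setT ((fun x => x + c) : R -> measurableTypeR R).
  exact: measurable_funD.
apply/esym.
have := @lebesgue_measure_unique R (pushforward m ((fun x => x + c) : R -> measurableTypeR R)).
apply => //.
move=> X [[a b] _ <-] /=; rewrite /pushforward.
rewrite -[X in _ = X]/(m _).
suff -> : (fun x => x + c) @^-1` `]a, b]%classic = `]a - c, b - c]%classic.
  rewrite !lebesgue_measure_itv /= !lte_fin ltrD2r -!EFinB.
  by case: ifP => // _; congr EFin; ring.
by apply/seteqP; split=> x /=; rewrite !in_itv /= ltrBlDr lerBrDr.
Qed.

End UnitMeasure.

(** * Dyadic cells and addresses *)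

Section Cells.
Context {R : realType}.
Local Notation I01 := (@I01 R).
Hint Resolve measurable_I01 : core.

Definition digit (x : R) : bool := 2^-1 <= x.

(** On [I01], multiplication by 2 modulo one; it drops the first binary digit. *)
Definition doubling (x : R) : R := 2 * x - (digit x)%:R.

(* Least significant binary digit = first digit of [x] after the point, so that
   the addresses of increasing rank are reductions of one 2-adic integer. *)
Fixpoint address (r : nat) (x : R) : nat :=
  if r is s.+1 then (digit x + (address s (doubling x)).*2)%N else 0%N.

(** Inverse branch of [iter r doubling] into the cell of address [i], for [i < 2 ^ r];
    [cellpt r i 0] is the left endpoint of that cell. *)
Fixpoint cellpt (r i : nat) (z : R) : R :=
  if r is s.+1 then ((odd i)%:R + cellpt s i./2 z) / 2 else z.

Definition dyset (r : nat) (P : pred nat) : set R :=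
  [set x | I01 x /\ P (address r x)].

Lemma I01P x : I01 x <-> 0 <= x < 1.
Proof. by rewrite /Defs.I01 /= in_itv. Qed.

Lemma doubling_I01 x : I01 x -> I01 (doubling x).
Proof.
rewrite !I01P /doubling /digit => /andP[x0 x1].
by case: (leP 2^-1 x) => h /=; apply/andP; split; lra.
Qed.

Lemma iter_doubling_I01 r x : I01 x -> I01 (iter r doubling x).
Proof. by move=> Ix; elim: r => //= r; exact: doubling_I01. Qed.

Lemma address_lt r x : (address r x < 2 ^ r)%N.
Proof.
elim: r x => //= r IH x; rewrite expnS; have := IH (doubling x).
by case: (digit x); lia.
Qed.

Lemma cellpt_address r x : cellpt r (address r x) (iter r doubling x) = x.
Proof.
elim: r x => //= r IH x.
rewrite -iterS iterSr half_bit_double IH oddD odd_double addbF oddb /doubling.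
by field.
Qed.

Lemma cellpt_I01 r i z : I01 z -> I01 (cellpt r i z).
Proof.
elim: r i => //= r IH i Iz; have := IH i./2 Iz.
rewrite !I01P => /andP[h0 h1].
by case: (odd i) => /=; apply/andP; split; lra.
Qed.

Lemma digit_cellpt r i z : I01 z -> digit (cellpt r.+1 i z) = odd i.
Proof.
move=> Iz /=; have := cellpt_I01 r i./2 Iz.
rewrite !I01P /digit => /andP[h0 h1].
by case: (odd i) => /=; [apply/idP; lra|apply/negbTE; rewrite -ltNge; lra].
Qed.

Lemma doubling_cellpt r i z : I01 z -> doubling (cellpt r.+1 i z) = cellpt r i./2 z.
Proof. by move=> Iz; rewrite /doubling digit_cellpt//=; field. Qed.

Lemma address_cellpt r i z : (i < 2 ^ r)%N -> I01 z -> address r (cellpt r i z) = i.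
Proof.
elim: r i => [|r IH] i; first by case: i.
move=> hi Iz; rewrite [LHS]/= -/(cellpt r.+1 i z) digit_cellpt// doubling_cellpt//.
rewrite IH//; first by rewrite odd_double_half.
by rewrite expnS in hi; lia.
Qed.

Lemma iter_doubling_cellpt r i z : I01 z -> iter r doubling (cellpt r i z) = z.
Proof.
elim: r i => // r IH i Iz.
by rewrite iterSr doubling_cellpt// IH.
Qed.

Lemma cellpt_affine r i z : cellpt r i z = cellpt r i 0 + z / 2 ^+ r.
Proof.
elim: r i => [|r IH] i /=; first by rewrite add0r expr0 divr1.
by rewrite IH exprS; field; rewrite ?expf_neq0.
Qed.

(** Digits beyond the first [r] are those of the [r]-th doubling iterate; they carry weight [2 ^ r]
    because the first digit is the least significant. *)
Lemma addressD r s x :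
  address (r + s) x = (address r x + 2 ^ r * address s (iter r doubling x))%N.
Proof.
elim: r x => [|r IH] x; first by rewrite /= mul1n.
by rewrite addSn /= IH -iterS iterSr expnS; lia.
Qed.

Lemma address_mod r s x : (r <= s)%N -> address r x = (address s x %% 2 ^ r)%N.
Proof.
move=> rs; rewrite -(subnKC rs) addressD.
by rewrite addnC mulnC modnMDl modn_small ?address_lt.
Qed.

Lemma address_le_eq r s x y : (r <= s)%N -> address s x = address s y ->
  address r x = address r y.
Proof. by move=> rs e; rewrite (address_mod _ rs) e -address_mod. Qed.

(** Both points are images of points of [I01] under one affine branch of slope [(2 ^+ r)^-1]. *)
Lemma address_dist r x y : I01 x -> I01 y -> address r x = address r y ->
  `|x - y| < (2 ^+ r)^-1.
Proof.
move=> Ix Iy e; rewrite -(cellpt_address r x) -(cellpt_address r y) e.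
rewrite cellpt_affine (cellpt_affine _ _ (iter r doubling y)).
have /I01P/andP[x0 x1] := iter_doubling_I01 r Ix.
have /I01P/andP[y0 y1] := iter_doubling_I01 r Iy.
set a := iter _ _ x in x0 x1 *; set b := iter _ _ y in y0 y1 *.
have -> : cellpt r (address r y) 0 + a / 2 ^+ r - (cellpt r (address r y) 0 + b / 2 ^+ r)
  = (a - b) / 2 ^+ r by ring.
have p0 : 0 < (2 ^+ r : R)^-1 by rewrite invr_gt0 exprn_gt0.
rewrite normrM (gtr0_norm p0) gtr_pMl// ltr_norml; lra.
Qed.

Lemma exp2_small (e : R) : 0 < e -> exists r, (2 ^+ r)^-1 < e.
Proof.
move=> e0; have [n /= _ hn] := near_infty_natSinv_lt (PosNum e0).
exists n.+1; apply: le_lt_trans (hn n (leqnn n)) => /=.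
rewrite lef_pV2 ?posrE ?exprn_gt0// -natrX ler_nat.
by rewrite ltnW// ltn_expl.
Qed.

Lemma exp2V_gt0 r : 0 < (2 ^+ r : R)^-1.
Proof. by rewrite invr_gt0 exprn_gt0. Qed.

Lemma exp2V_le r s : (r <= s)%N -> (2 ^+ s : R)^-1 <= (2 ^+ r)^-1.
Proof.
by move=> rs; rewrite lef_pV2 ?posrE ?exprn_gt0// ler_weXn2l// ler1n.
Qed.

Lemma address_inj x y : I01 x -> I01 y -> (forall r, address r x = address r y) ->
  x = y.
Proof.
move=> Ix Iy e; apply/eqP; rewrite -subr_eq0 -normr_le0 leNgt; apply/negP => h.
have [r hr] := exp2_small h.
by have := address_dist Ix Iy (e r); rewrite ltNge (ltW hr).
Qed.

Lemma cellE r i : (i < 2 ^ r)%N ->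
  dyset r (pred1 i) = `[cellpt r i 0, cellpt r i 0 + (2 ^+ r)^-1[%classic.
Proof.
move=> hi; have p0 := exp2V_gt0 r.
apply/seteqP; split=> x /=; rewrite in_itv /=.
  move=> [Ix /eqP e]; rewrite -(cellpt_address r x) e (cellpt_affine _ _ (iter r doubling x)).
  have /I01P/andP[x0 x1] := iter_doubling_I01 r Ix.
  rewrite lerDl mulr_ge0 ?(ltW p0)//= ltrD2l gtr_pMl//.
(* [z] is the position of [x] inside the cell, rescaled to [I01]. *)
move=> /andP[h1 h2]; pose z := (x - cellpt r i 0) * 2 ^+ r.
have Iz : I01 z.
  rewrite I01P /z mulr_ge0 ?subr_ge0 ?exprn_ge0//=.
  by rewrite -ltr_pdivlMr ?exprn_gt0// mul1r ltrBlDl.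
have ex : x = cellpt r i z.
  by rewrite cellpt_affine /z mulfK ?addrNK ?subrKC// expf_neq0.
by rewrite ex; split; [exact: cellpt_I01|rewrite /= address_cellpt].
Qed.

Lemma dyset_bigcup r P :
  dyset r P = \bigcup_(i in [set i | (i < 2 ^ r)%N && P i]) dyset r (pred1 i).
Proof.
apply/seteqP; split=> [x [Ix Px]|x [i /= /andP[_ Pi] [Ix /eqP e]]].
  by exists (address r x) => /=; [rewrite address_lt Px|split => //; exact: eqxx].
by split=> //; rewrite e.
Qed.

Lemma measurable_dyset r P : measurable (dyset r P).
Proof.
rewrite dyset_bigcup; apply: bigcup_measurable => i /= /andP[hi _].
by rewrite cellE//; exact: measurable_itv.
Qed.
Hint Resolve measurable_dyset : core.

Lemma mu_cell r i : (i < 2 ^ r)%N -> mu (dyset r (pred1 i)) = (2 ^+ r)^-1.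
Proof.
move=> hi; apply: EFin_inj; rewrite -m_muS//; last by move=> x [].
rewrite cellE// lebesgue_measure_itv /= lte_fin ltrDl exp2V_gt0.
by rewrite -EFinB; congr EFin; ring.
Qed.

Lemma mu_setI_dyset (A : set R) r P : measurable A ->
  mu (A `&` dyset r P) = \sum_(i < 2 ^ r | P i) mu (A `&` dyset r (pred1 (i : nat))).
Proof.
move=> mA.
have mAd Q : measurable (A `&` dyset r Q) by exact: measurableI.
suff H n : (n <= 2 ^ r)%N -> mu (A `&` dyset r [pred i | (i < n)%N && P i]) =
    \sum_(i < n | P i) mu (A `&` dyset r (pred1 (i : nat))).
  rewrite -H//; congr (mu (_ `&` _)).
  by apply/seteqP; split=> x [Ix] /=; rewrite /dyset /= address_lt.
elim: n => [_|n IH hn].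
  rewrite big_ord0 -mu_set0; congr mu; apply/seteqP; split=> // x [_ []].
  by [].
rewrite big_mkcond big_ord_recr -big_mkcond /= -IH 1?ltnW//.
have -> : (if P n then mu (A `&` dyset r (pred1 n)) else 0) =
    mu (A `&` dyset r [pred i | (i == n) && P i]).
  case Pn: (P n).
    congr (mu (_ `&` _)); apply/seteqP; split=> x [Ix] /=; rewrite /dyset /=.
      by move=> e; split=> //; rewrite e (eqP e) Pn.
    by move=> /andP[].
  rewrite -mu_set0; congr mu; apply/seteqP; split=> // x [_ [Ix]] /=.
  by move=> /andP[/eqP ->]; rewrite Pn.
rewrite -muU//.
  rewrite -setIUr; congr (mu (_ `&` _)).
  apply/seteqP; split=> x /=; rewrite /dyset /=.
    move=> [Ix]; rewrite ltnS leq_eqVlt => /andP[/orP[h|h] Px]; [right|left];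
    by rewrite h Px.
  by case=> -[Ix /andP[h Px]]; split=> //; rewrite Px ltnS leq_eqVlt h ?orbT.
apply/seteqP; split=> // x [[[_ [_ /= /andP[h _]]] [_ [_ /= /andP[/eqP e _]]]] _].
by rewrite e ltnn in h.
Qed.

Lemma mu_dyset r P :
  mu (dyset r P) = #|[pred i : 'I_(2 ^ r) | P i]|%:R / 2 ^+ r.
Proof.
have dI Q : dyset r Q = I01 `&` dyset r Q by rewrite setIidr// => x [].
rewrite dI mu_setI_dyset//.
under eq_bigr => i _ do rewrite -dI mu_cell//.
by rewrite big_const iter_addr_0 mulr_natl.
Qed.

End Cells.

(** * Measure-preserving bijections *)

Section MeasurePreserving.
Context {R : realType}.
Local Notation I01 := (@I01 R).
Local Notation m := (@lebesgue_measure R).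
Local Notation dyset := (@dyset R).
Hint Resolve measurable_I01 measurable_dyset : core.

Lemma measurable_symdiff (A B : set R) : measurable A -> measurable B ->
  measurable (symdiff A B).
Proof. by move=> mA mB; apply: measurableU; apply: measurableD. Qed.

(** Outer regularity reduces to an open set, whose part in [I01] is the increasing union over [r] of
    the cells of rank [r] inside it. All large ranks work, so that several sets can later share one
    rank. *)
Lemma dyset_approx (A : set R) (e : R) : measurable A -> 0 < e ->
  exists r0, forall r, (r0 <= r)%N ->
  exists P : pred nat, mu (symdiff A (dyset r P)) < e.
Proof.
move=> mA e0.
have e20 : 0 < e / 2 by lra.
have mAI : measurable (A `&` I01) by exact: measurableI.
have [|U [oU AU mUA]] := lebesgue_regularity_outer mAI _ e20.
  by rewrite -[X in (X < _)%E]/(m (A `&` I01)) m_mu// ltry.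
have mU : measurable U by exact: open_measurable.
pose P r i := `[< forall y, I01 y -> address r y = i -> U y >].
have Pinc r s : (r <= s)%N -> dyset r (P r) `<=` dyset s (P s).
  move=> rs x [Ix /asboolP Px]; split=> //; apply/asboolP => y Iy e1.
  by apply: Px => //; exact: address_le_eq rs e1.
have UP : mu U = mu (\bigcup_r dyset r (P r)).
  rewrite -muI_I01; congr mu; apply/seteqP; split=> [x [Ux Ix]|x [r _ [Ix /asboolP]]].
    have /nbhs_ballP[d /= d0 hd] := open_nbhs_nbhs (conj oU Ux).
    have [r hr] := exp2_small d0.
    exists r => //; split=> //; apply/asboolP => y Iy exy.
    apply: hd; rewrite /ball /=; apply: lt_trans hr.
    exact: address_dist.
  by move=> h; split=> //; exact: h.
have [|||r0 hr0] := @mu_up _ (fun r => dyset r (P r)) (mu U - e / 2).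
- by [].
- by move=> r; exact: Pinc.
- by rewrite -UP; lra.
exists r0 => r r0r; exists (P r).
have h1 : mu (U `\` dyset r (P r)) < e / 2.
  have h2 := muDI mU (measurable_dyset r (P r)).
  have h3 : mu (dyset r0 (P r0)) <= mu (U `&` dyset r (P r)).
    apply: mu_mono => //; first exact: measurableI.
    move=> x [h _]; have h' := Pinc _ _ r0r _ h; split=> //.
    by case: h' => Ix /asboolP; exact.
  by lra.
have mUA' : measurable (U `\` (A `&` I01)) by exact: measurableD.
have h4 : mu (U `\` (A `&` I01)) < e / 2.
  rewrite -lte_fin; apply: le_lt_trans mUA; rewrite -m_mu//.
  apply: le_measure; rewrite ?inE; last by move=> x [].
    exact: measurableI mUA' measurable_I01.
  exact: mUA'.
apply: (@le_lt_trans _ _ (mu (U `\` dyset r (P r)) + mu (U `\` (A `&` I01)))); last by lra.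
apply: muU_le.
- exact: measurable_symdiff.
- by apply: measurableD => //; exact: measurable_dyset.
- by [].
move=> x [[[Ax nPx]|[[Ix Px] nAx]] Ix']; first by left; split=> //; exact: AU.
by right; split; [move/asboolP: Px; exact|move=> []].
Qed.

Lemma inM_maps (tau : R -> R) x : inM tau -> I01 x -> I01 (tau x).
Proof. by move=> [[h _ _] _] Ix; exact: h. Qed.

Lemma inM_inj (tau : R -> R) x y : inM tau -> I01 x -> I01 y -> tau x = tau y -> x = y.
Proof. by move=> [[_ h _] _] Ix Iy; apply: h; rewrite inE. Qed.

Lemma inM_surj (tau : R -> R) y : inM tau -> I01 y -> exists2 x, I01 x & tau x = y.
Proof. by move=> [[_ _ h] _] Iy; have [x Ix e] := h y Iy; exists x. Qed.

Lemma inM_image (tau : R -> R) (A : set R) : inM tau -> measurable A -> A `<=` I01 ->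
  [/\ measurable (tau @` A), tau @` A `<=` I01 & mu (tau @` A) = mu A].
Proof.
move=> tM mA AI; have [_ /(_ A mA AI) [h1 [h2 _]]] := tM.
have tI : tau @` A `<=` I01 by move=> _ [x Ax <-]; apply: inM_maps tM (AI x Ax).
by split=> //; apply: EFin_inj; rewrite -!m_muS.
Qed.

Lemma inM_preimage (tau : R -> R) (A : set R) : inM tau -> measurable A ->
  measurable (tau @^-1` A `&` I01) /\ mu (tau @^-1` A `&` I01) = mu A.
Proof.
move=> tM mA.
have mAI : measurable (A `&` I01) by exact: measurableI.
have [_ /(_ (A `&` I01) mAI (@subIsetr _ _ _)) [_ [_ [h1 h2]]]] := tM.
have <- : tau @^-1` (A `&` I01) `&` I01 = tau @^-1` A `&` I01.
  apply/seteqP; split=> x; first by move=> [[]].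
  by move=> [Ax Ix]; split=> //; split=> //; apply: inM_maps tM Ix.
split=> //; apply: EFin_inj; rewrite -(muI_I01 A) -!m_muS//; by move=> x [].
Qed.

(** By surjectivity [f] maps the preimage of [A] onto [A], so the measure of the preimage follows
    from the hypothesis on images. *)
Lemma inM_intro (f : R -> R) : set_bij I01 I01 f ->
  (forall A, measurable A -> A `<=` I01 -> measurable (f @` A) /\ m (f @` A) = m A) ->
  (forall A, measurable A -> A `<=` I01 -> measurable (f @^-1` A `&` I01)) ->
  inM f.
Proof.
move=> bf fimg fpre; split=> // A mA AI.
have [mfA efA] := fimg A mA AI; have mpA := fpre A mA AI.
do 3 split=> //.
have [_ <-] := fimg _ mpA (@subIsetr _ _ _); congr m.
case: bf => _ _ sf; apply/seteqP; split=> [_ [x [Ax _] <-]//|y Ay].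
by have [x Ix e] := sf y (AI y Ay); exists x => //; split=> //=; rewrite e.
Qed.

Lemma inM_comp (f g : R -> R) : inM f -> inM g -> inM (f \o g).
Proof.
move=> fM gM; apply: inM_intro.
- split=> [x Ix|x y|y Iy].
  + by apply: (inM_maps fM); exact: inM_maps Ix.
  + rewrite !inE => Ix Iy /(inM_inj fM (inM_maps gM Ix) (inM_maps gM Iy)).
    exact: inM_inj.
  + have [z Iz <-] := inM_surj fM Iy; have [x Ix <-] := inM_surj gM Iz.
    by exists x.
- move=> A mA AI; rewrite -image_comp.
  have [mgA gAI egA] := inM_image gM mA AI; have [mfA fAI efA] := inM_image fM mgA gAI.
  by split=> //; rewrite !m_muS// efA egA.
- move=> A mA AI; have [mfA _] := inM_preimage fM mA.
  have [mgA _] := inM_preimage gM mfA.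
  suff -> : (f \o g) @^-1` A `&` I01 = g @^-1` (f @^-1` A `&` I01) `&` I01 by [].
  apply/seteqP; split=> x; last by move=> [[]].
  by move=> [Ax Ix]; split=> //; split=> //; exact: inM_maps gM Ix.
Qed.

Lemma inM_id : inM (@id R).
Proof.
apply: inM_intro => [|A mA AI|A mA AI].
- by split=> [x Ix|x y _ _|y Iy] //; exists y.
- by rewrite image_id.
- exact: measurableI.
Qed.

Lemma inM_iter (tau : R -> R) n : inM tau -> inM (iter n tau).
Proof.
move=> tM; elim: n => [|n IH]; first exact: inM_id.
exact: (inM_comp tM IH).
Qed.

(** Making the cover disjoint splits images and preimages into countably many translates of
    measurable sets. *)
Lemma inM_piecewise_translation (f : R -> R) (E : nat -> set R) (c : nat -> R) :
  set_bij I01 I01 f -> (forall i, measurable (E i)) ->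
  (forall x, I01 x -> exists i, E i x) ->
  (forall i x, I01 x -> E i x -> f x = x + c i) -> inM f.
Proof.
move=> bf mE covE fE.
pose F := seqDU E.
have mF i : measurable (F i).
  by apply: measurableD => //; exact: bigsetU_measurable.
have covF A : A `<=` I01 -> A = \bigcup_i (A `&` F i).
  move=> AI; rewrite -setI_bigcupr -seqDU_bigcup_eq setIidl// => x Ax.
  by have [i] := covE x (AI x Ax); exists i.
have fF i x : I01 x -> F i x -> f x = x + c i.
  by move=> Ix [Fx _]; exact: fE.
have imgF i (A : set R) : A `<=` I01 ->
    f @` (A `&` F i) = (fun x => x + - c i) @^-1` (A `&` F i).
  move=> AI; apply/seteqP; split=> [_ [x [Ax Fx] <-]|x /= [Ax Fx]].
    by rewrite /= (fF i) ?addrK//; exact: AI.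
  by exists (x - c i) => //; rewrite (fF i) ?subrK//; exact: AI.
apply: inM_intro => // A mA AI.
- have mAF i : measurable (A `&` F i) by exact: measurableI.
  have mfAF i : measurable (f @` (A `&` F i)) by rewrite imgF//; exact: measurable_shift.
  rewrite {1 2}(covF A AI) image_bigcup; split; first exact: bigcupT_measurable.
  have tF : trivIset setT (fun i => f @` (A `&` F i)).
    apply/trivIsetP => i j _ _ ij.
    apply/seteqP; split=> // y [[x [Ax Fx] <-] [x' [Ax' Fx'] e]].
    have xx' : x' = x by case: bf => _ injf _; apply: injf; rewrite ?inE//; exact: AI.
    have /trivIsetP/(_ i j Logic.I Logic.I ij) := @trivIset_seqDU _ E.
    by move/seteqP => [/(_ x) + _]; apply; split=> //; rewrite xx' in Fx'.
  have tAF : trivIset setT (fun i => A `&` F i) by exact/trivIset_setIl/trivIset_seqDU.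
  have -> := measure_bigcup m setT _ (fun i _ => mfAF i) tF.
  rewrite [X in _ = _ X](covF A AI).
  have -> := measure_bigcup m setT _ (fun i _ => mAF i) tAF.
  by apply: eq_eseriesr => i _; rewrite imgF//; exact: m_shift.
- have -> : f @^-1` A `&` I01 = \bigcup_i ((fun x => x + c i) @^-1` A `&` F i `&` I01).
    apply/seteqP; split=> [x [Ax Ix]|x [i _ [[Ax Fx] Ix]]].
      have : I01 x by []. rewrite {1}(covF I01 (@subset_refl _ _)) => -[i _ [_ Fx]].
      by exists i => //; split=> //; split=> //=; rewrite -(fF i).
    by split=> //=; rewrite (fF i).
  apply: bigcupT_measurable => i; apply: measurableI => //.
  exact: measurableI (measurable_shift _ mA) (mF i).
  exact: measurable_I01.
Qed.

End MeasurePreserving.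

(** * The dyadic odometer *)

Section Odometer.
Context {R : realType}.
Local Notation I01 := (@I01 R).
Local Notation m := (@lebesgue_measure R).
Local Notation dyset := (@dyset R).
Local Notation address := (@address R).
Local Notation doubling := (@doubling R).
Local Notation cellpt := (@cellpt R).
Hint Resolve measurable_I01 measurable_dyset : core.

Lemma I01_0 : I01 0. Proof. by rewrite I01P lexx ltr01. Qed.
Hint Resolve I01_0 : core.

Lemma address0 r : address r 0 = 0%N.
Proof.
elim: r => //= r IH.
have -> : digit (0 : R) = false by apply/negbTE; rewrite /digit -ltNge; lra.
have -> : doubling 0 = 0.
  by rewrite /(doubling _) /digit; case: (leP 2^-1 (0 : R)) => /=; lra.
by rewrite IH.
Qed.

Lemma cellpt_max r : cellpt r (2 ^ r).-1 0 = 1 - (2 ^+ r)^-1.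
Proof.
elim: r => [|r IH]; first by rewrite /= expr0 invr1 subrr.
have e0 : (0 < 2 ^ r)%N by rewrite expn_gt0.
have -> : (2 ^ r.+1).-1 = (true + (2 ^ r).-1.*2)%N by rewrite expnS; lia.
rewrite -[LHS]/((_ + cellpt r _ 0) / 2) half_bit_double IH oddD odd_double exprS /=.
by field; rewrite expf_neq0.
Qed.

(** [i] is the number of ones before the first zero digit. If all digits were one, [x] would be at
    least [1 - (2 ^+ r)^-1] for every [r], contradicting [x < 1]. *)
Lemma ex_address_zero_digit x : I01 x -> exists i, address i.+1 x = (2 ^ i).-1.
Proof.
move=> Ix.
have ex : exists r, address r x != (2 ^ r).-1.
  apply: contrapT => /forallNP h.
  have hx : 0 < 1 - x by move/I01P: Ix; lra.
  have [r hr] := exp2_small hx.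
  have e : address r x = (2 ^ r).-1 by have /negP/negPn/eqP := h r.
  have := cellpt_address r x; rewrite e cellpt_affine cellpt_max => ex.
  have /I01P/andP[z0 _] := iter_doubling_I01 r Ix.
  have : 0 <= iter r doubling x / 2 ^+ r by rewrite mulr_ge0// ltW// exp2V_gt0.
  by lra.
have [[|i] hi min] := ex_minnP ex; first by [].
exists i.
have e : address i x = (2 ^ i).-1.
  by apply/eqP; apply/negPn/negP => /min; rewrite ltnn.
have e0 : (0 < 2 ^ i)%N by rewrite expn_gt0.
move: hi; rewrite -addn1 addressD e /= addn0 expnD.
by case: digit => /=; lia.
Qed.

Lemma ex_address_one_digit x : I01 x -> x != 0 -> exists i, address i.+1 x = (2 ^ i)%N.
Proof.
move=> Ix x0.
have ex : exists r, address r x != 0%N.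
  apply: contrapT => /forallNP h; move/eqP: x0; apply.
  apply: address_inj => // r; rewrite address0.
  by have /negP/negPn/eqP := h r.
have [[|i] hi min] := ex_minnP ex; first by [].
exists i.
have e : address i x = 0%N.
  by apply/eqP; apply/negPn/negP => /min; rewrite ltnn.
by move: hi; rewrite -addn1 addressD e /= addn0; case: digit => /=; lia.
Qed.

(** Addition of 1 when the carry stops at a zero preceded by [i] ones: the ones become zeros, the
    zero becomes a one, later digits stay. *)
Definition carry_step i (x : R) : R := cellpt i.+1 (2 ^ i) (iter i.+1 doubling x).

Lemma carry_step_I01 i x : I01 x -> I01 (carry_step i x).
Proof. by move=> Ix; apply: cellpt_I01; exact: iter_doubling_I01. Qed.

Lemma address_carry_step i x r : I01 x -> address i.+1 x = (2 ^ i).-1 ->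
  address r (carry_step i x) = ((address r x + 1) %% 2 ^ r)%N.
Proof.
move=> Ix e.
have e0 : (0 < 2 ^ i)%N by rewrite expn_gt0.
have hi : (2 ^ i < 2 ^ i.+1)%N by rewrite ltn_exp2l.
have Iz := iter_doubling_I01 i.+1 Ix.
have es : address i.+1 (carry_step i x) = (2 ^ i)%N by rewrite address_cellpt.
case: (leqP r i.+1) => h.
  rewrite (address_mod _ h) es (address_mod x h) e modnDml; congr (_ %% _)%N.
  by lia.
rewrite -(subnKC (ltnW h)) !addressD es e iter_doubling_cellpt//.
(* The new value is itself an address, hence below the modulus, so both sides can be compared after
   reduction. *)
have lt := address_lt (i.+1 + (r - i.+1)) (carry_step i x).
rewrite addressD es iter_doubling_cellpt// in lt.
by rewrite -[in LHS](modn_small lt); congr (_ %% _)%N; lia.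
Qed.

(** On [I01] the selected index is the place where the carry stops, by [ex_address_zero_digit]. *)
Definition odo_map (x : R) : R :=
  carry_step (xget 0%N [set i | address i.+1 x = (2 ^ i).-1]) x.

Lemma odo_mapP x : I01 x ->
  exists2 i, address i.+1 x = (2 ^ i).-1 & odo_map x = carry_step i x.
Proof.
move=> /ex_address_zero_digit [i hi].
have h := @xgetI _ 0%N [set i | address i.+1 x = (2 ^ i).-1] i hi.
by exists (xget 0%N [set i | address i.+1 x = (2 ^ i).-1]).
Qed.

Lemma address_odo_map x r : I01 x -> address r (odo_map x) = ((address r x + 1) %% 2 ^ r)%N.
Proof. by move=> Ix; have [i e ->] := odo_mapP Ix; exact: address_carry_step. Qed.

Lemma odo_map_I01 x : I01 x -> I01 (odo_map x).
Proof. by move=> Ix; have [i e ->] := odo_mapP Ix; exact: carry_step_I01. Qed.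

Lemma odo_mapE i x : I01 x -> address i.+1 x = (2 ^ i).-1 -> odo_map x = carry_step i x.
Proof.
move=> Ix e; apply: address_inj => [||r]; [exact: odo_map_I01|exact: carry_step_I01|].
by rewrite address_odo_map// address_carry_step.
Qed.

Lemma odo_map_inj x y : I01 x -> I01 y -> odo_map x = odo_map y -> x = y.
Proof.
move=> Ix Iy e; apply: address_inj => // r.
have := address_odo_map r Ix; rewrite e address_odo_map// => /eqP.
by rewrite eqn_modDr !modn_small ?address_lt// => /eqP.
Qed.

Lemma odo_map_neq0 x : I01 x -> odo_map x <> 0.
Proof.
move=> Ix; have [i e ->] := odo_mapP Ix => e0.
have hi : (2 ^ i < 2 ^ i.+1)%N by rewrite ltn_exp2l.
have := address_cellpt hi (iter_doubling_I01 i.+1 Ix).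
rewrite -/(carry_step i x) e0 address0.
by have := expn_gt0 2 i; lia.
Qed.

Lemma odo_map_surj y : I01 y -> y != 0 -> exists2 x, I01 x & odo_map x = y.
Proof.
move=> Iy y0; have [i ei] := ex_address_one_digit Iy y0.
have Iz := iter_doubling_I01 i.+1 Iy.
have hi : ((2 ^ i).-1 < 2 ^ i.+1)%N.
  by have : (0 < 2 ^ i)%N; [rewrite expn_gt0|rewrite expnS; lia].
exists (cellpt i.+1 (2 ^ i).-1 (iter i.+1 doubling y)); first exact: cellpt_I01.
rewrite (@odo_mapE i); [|exact: cellpt_I01|by rewrite address_cellpt].
by rewrite /carry_step iter_doubling_cellpt// -ei cellpt_address.
Qed.

Definition orbit0 : set R := range (fun n => iter n odo_map 0).

(* [odo_map] misses 0; fixing the (null) forward orbit of 0 makes it a bijection. *)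
Definition odo (x : R) : R := if `[< orbit0 x >] then x else odo_map x.

Lemma countable_orbit0 : countable orbit0.
Proof. exact: sub_countable (card_image_le _ _) (countableP _). Qed.

Lemma measurable_orbit0 : measurable orbit0.
Proof. by apply: countable_measurable countable_orbit0 => t; exact: measurable_set1. Qed.

Lemma mu_orbit0 : mu orbit0 = 0.
Proof.
rewrite /mu countable_lebesgue_measure0//.
by apply: sub_countable countable_orbit0; apply: subset_card_le => x [].
Qed.

Lemma iter_odo_map_I01 n : I01 (iter n odo_map 0).
Proof. by elim: n => //= n IH; exact: odo_map_I01. Qed.

(** Backward invariance holds because [odo_map] is injective on [I01] and never takes the value 0
    there. *)
Lemma orbit0_odo_map x : I01 x -> orbit0 (odo_map x) <-> orbit0 x.
Proof.
move=> Ix; split=> [[[|n] _ /= e]|[n _ <-]].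
- by have := odo_map_neq0 Ix; rewrite -e.
- exists n => //; apply: odo_map_inj e => //; exact: iter_odo_map_I01.
- by exists n.+1.
Qed.

Lemma odoE x : ~ orbit0 x -> odo x = odo_map x.
Proof. by rewrite /odo; case: asboolP. Qed.

Lemma odo_id x : orbit0 x -> odo x = x.
Proof. by rewrite /odo; case: asboolP. Qed.

Lemma odo_orbit0 x : I01 x -> orbit0 (odo x) <-> orbit0 x.
Proof.
move=> Ix; have [Ox|nOx] := pselect (orbit0 x); first by rewrite odo_id.
by rewrite odoE// orbit0_odo_map.
Qed.

Lemma odo_inM : inM odo.
Proof.
(* [E 0] is the fixed orbit of 0; [E i.+1] collects the other points whose carry stops after [i]
   ones, all displaced by the difference of the left endpoints of two cells. *)
pose E n := if n is i.+1 then dyset i.+1 (pred1 (2 ^ i).-1) `\` orbit0 else orbit0.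
pose c n := if n is i.+1 then cellpt i.+1 (2 ^ i) 0 - cellpt i.+1 (2 ^ i).-1 0 else 0 : R.
apply: (@inM_piecewise_translation _ _ E c).
- split=> [x Ix|x y|y Iy].
  + by rewrite /odo; case: ifP => // _; exact: odo_map_I01.
  + rewrite !inE => Ix Iy.
    have [Ox|nOx] := pselect (orbit0 x); have [Oy|nOy] := pselect (orbit0 y).
    * by rewrite !odo_id.
    * by rewrite (odo_id Ox) (odoE nOy) => e; case: nOy; apply/orbit0_odo_map; rewrite -?e.
    * by rewrite (odo_id Oy) (odoE nOx) => e; case: nOx; apply/orbit0_odo_map; rewrite ?e.
    * by rewrite !odoE//; exact: odo_map_inj.
  + have [Oy|nOy] := pselect (orbit0 y); first by exists y; rewrite ?odo_id.
    have [|x Ix e] := @odo_map_surj y Iy.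
      by apply/eqP => e; case: nOy; exists 0%N.
    exists x => //; rewrite odoE// => Ox; case: nOy; rewrite -e.
    exact/orbit0_odo_map.
- by case=> [|i]; [exact: measurable_orbit0|exact: measurableD (measurable_dyset _ _) measurable_orbit0].
- move=> x Ix; have [Ox|nOx] := pselect (orbit0 x); first by exists 0%N.
  have [i hi] := ex_address_zero_digit Ix.
  by exists i.+1; split=> //; split=> //; exact/eqP.
- have c0 : c 0%N = 0 by [].
  have cS i : c i.+1 = cellpt i.+1 (2 ^ i) 0 - cellpt i.+1 (2 ^ i).-1 0 by [].
  case=> [|i] x Ix; first by move=> Ox; rewrite odo_id// c0 addr0.
  move=> [[_ /eqP e] nOx]; rewrite odoE// (odo_mapE Ix e) /carry_step.
  rewrite -[X in _ = X + _](cellpt_address i.+1 x) e cS.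
  rewrite (cellpt_affine _ (2 ^ i)) (cellpt_affine _ (2 ^ i).-1 (iter _ _ _)).
  by rewrite [RHS]addrC addrA subrK.
Qed.

Lemma iter_odo x n : I01 x -> ~ orbit0 x ->
  [/\ I01 (iter n odo x), ~ orbit0 (iter n odo x) &
   forall r, address r (iter n odo x) = ((address r x + n) %% 2 ^ r)%N].
Proof.
move=> Ix nOx; elim: n => [|n [IH1 IH2 IH3]].
  by split=> // r; rewrite addn0 modn_small ?address_lt.
rewrite iterS; split.
- exact: inM_maps odo_inM IH1.
- by move/(odo_orbit0 IH1).
- by move=> r; rewrite odoE// address_odo_map// IH3 modnDml -addnA addn1.
Qed.

Lemma mu_eq_null (A B N : set R) : measurable A -> measurable B -> measurable N ->
  mu N = 0 -> (forall x, I01 x -> ~ N x -> A x <-> B x) -> mu A = mu B.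
Proof.
move=> mA mB mN N0 AB; apply/eqP; rewrite eq_le; apply/andP; split.
- rewrite -[leRHS]addr0 -N0; apply: muU_le => // x [Ax Ix].
  by have [Nx|nNx] := pselect (N x); [right|left; apply/AB].
- rewrite -[leRHS]addr0 -N0; apply: muU_le => // x [Bx Ix].
  by have [Nx|nNx] := pselect (N x); [right|left; apply/AB].
Qed.

(** Up to a null set, the [n]-th iterate carries the cell 0 of rank [r] to the cell [n], so an
    invariant set meets all cells of rank [r] in the same measure. *)
Lemma odo_invariant_indep (A : set R) r P : measurable A -> A `<=` I01 ->
  odo @^-1` A `&` I01 = A -> mu (A `&` dyset r P) = mu A * mu (dyset r P).
Proof.
move=> mA AI inv.
have iterA n x : I01 x -> A (iter n odo x) <-> A x.
  elim: n x => // n IH x Ix; rewrite iterSr IH; last exact: inM_maps odo_inM Ix.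
  by split=> [h|]; [rewrite -inv|rewrite -{1}inv => -[]].
have mAd Q : measurable (A `&` dyset r Q) by exact: measurableI.
have p0 : (0 < 2 ^ r)%N by rewrite expn_gt0.
have cell n : (n < 2 ^ r)%N ->
    mu (A `&` dyset r (pred1 n)) = mu (A `&` dyset r (pred1 0%N)).
  move=> hn; have [h1 h2] := inM_preimage (inM_iter n odo_inM) (mAd (pred1 n)).
  rewrite -h2; apply: mu_eq_null measurable_orbit0 mu_orbit0 _ => // x Ix nOx.
  have [I1 _ ar] := iter_odo n Ix nOx.
  split=> [[[An [_ /= en]] _]|[Ax [_ /eqP e0]]].
    split; first exact/(iterA n).
    split=> //; move: en; rewrite /= ar -{2}(modn_small hn) -{2}(add0n n) eqn_modDr.
    by rewrite mod0n modn_small ?address_lt.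
  split=> //; split; first exact/(iterA n).
  by split=> //=; rewrite ar e0 add0n modn_small.
have sumP Q : mu (A `&` dyset r Q) =
    #|[pred i : 'I_(2 ^ r) | Q i]|%:R * mu (A `&` dyset r (pred1 0%N)).
  rewrite mu_setI_dyset// (eq_bigr (fun _ => mu (A `&` dyset r (pred1 0%N)))).
    by rewrite big_const iter_addr_0 mulr_natl.
  by move=> i _; rewrite cell.
have -> : mu A = mu (A `&` dyset r predT).
  by congr mu; rewrite setIidl// => x Ax; split=> //; exact: AI.
rewrite (sumP P) (sumP predT) mu_dyset; set a := mu _.
have -> : #|[pred i : 'I_(2 ^ r) | predT (i : nat)]| = (2 ^ r)%N.
  by rewrite -[RHS]card_ord; apply: eq_card.
by rewrite natrX [RHS]mulrC mulrA divfK// expf_neq0.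
Qed.

(** An invariant set is independent of all dyadic sets, and these approximate it, so it is
    independent of itself and its measure equals its own square. *)
Lemma odo_ergodic : ergodic odo.
Proof.
move=> A mA AI inv.
suff : mu A * (1 - mu A) <= 0.
  have a0 := mu_ge0 A; have a1 := mu_le1 mA.
  rewrite m_muS//; move=> h.
  have /eqP : mu A * (1 - mu A) = 0 by apply/eqP; rewrite eq_le h mulr_ge0// subr_ge0.
  rewrite mulf_eq0 subr_eq0 => /orP[/eqP ->|/eqP <-]; by [left|right].
rewrite leNgt; apply/negP => h.
(* The approximation error enters twice, through the intersection with [A] and through the measure
   of the dyadic set, hence the factor 1/2. *)
have [|r0 /(_ r0 (leqnn _)) [P hP]] := @dyset_approx R A (mu A * (1 - mu A) / 2) mA.
  by lra.
have ind := odo_invariant_indep r0 P mA AI inv.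
have mD := measurable_dyset r0 P : measurable (dyset r0 P).
have hA := muDI mA mD; have hD := muDI mD mA; rewrite (setIC (dyset r0 P)) in hD.
have s1 : mu (A `\` dyset r0 P) <= mu (symdiff A (dyset r0 P)).
  apply: mu_mono; [exact: measurableD|exact: measurable_symdiff|by move=> x []; left].
have s2 : mu (dyset r0 P `\` A) <= mu (symdiff A (dyset r0 P)).
  apply: mu_mono; [exact: measurableD|exact: measurable_symdiff|by move=> x []; right].
have a0 := mu_ge0 A; have a1 := mu_le1 mA.
have d0 := mu_ge0 (A `\` dyset r0 P).
move: h hP; set e := mu A * _ => h hP.
have : mu A * mu (dyset r0 P) <= mu A * (mu A + e / 2) by apply: ler_wpM2l => //; lra.
have : mu A * (e / 2) <= 1 * (e / 2) by apply: ler_wpM2r => //; lra.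
have : e = mu A - mu A * mu A by rewrite /e; ring.
rewrite mulrDr; lra.
Qed.

End Odometer.

(** * Second moment of the number of hits *)

Section SecondMoment.
Context {R : realType}.
Local Notation I01 := (@I01 R).
Local Notation dyset := (@dyset R).
Local Notation address := (@address R).
Hint Resolve measurable_I01 measurable_dyset : core.

(** Each multiple of [s] is charged to the [s] indices ending at it, whose weights are at least as
    large. *)
Lemma sum_multiples_le (w : nat -> R) (s n t : nat) : (0 < s)%N ->
  (forall i, 0 <= w i) -> (forall i j, (i <= j)%N -> w j <= w i) ->
  s%:R * \sum_(j < t) (s %| j.+1)%:R * w (n + j.+1)%N <=
  \sum_(j < t) w (n + j.+1)%N.
Proof.
move=> s0 w0 wdec; rewrite -subr_ge0.
(* Strengthening for the induction: the [t %% s] terms after the last multiple of [s] are still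
   uncharged, each at least [w (n + t)]. *)
apply: (@le_trans _ _ ((t %% s)%:R * w (n + t)%N)); first exact: mulr_ge0.
elim: t => [|t IH]; first by rewrite !big_ord0 mulr0 subrr mod0n mul0r.
rewrite !big_ord_recr /= mulrDr.
have wt : w (n + t.+1)%N <= w (n + t)%N by apply: wdec; lia.
have w1 := w0 (n + t.+1)%N.
have tle : (t %% s)%:R * w (n + t.+1)%N <= (t %% s)%:R * w (n + t)%N.
  exact: ler_wpM2l.
case: (boolP (s %| t.+1)%N) => h.
  rewrite (eqP (h : (t.+1 %% s)%N == 0%N)) mul0r mul1r.
  have e : (t %% s = s.-1)%N.
    have := ltn_pmod t s0; move: h; rewrite /dvdn -addn1 -modnDml.
    move: (t %% s)%N => b /eqP hb bs; case: (ltnP b s.-1) => hs; last by lia.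
    by move: hb; rewrite modn_small; lia.
  have es : s%:R = s.-1%:R + 1 :> R by rewrite natr1 prednK.
  by move: IH tle; rewrite e es; lra.
rewrite mul0r mulr0 addr0.
have -> : (t.+1 %% s = (t %% s).+1)%N.
  have hs := ltn_pmod t s0; move: h; rewrite /dvdn -addn1 -modnDml addn1.
  move: (t %% s)%N hs => b bs; case: (ltnP b.+1 s) => hs hb; first by rewrite modn_small.
  by have e : b.+1 = s; [lia|rewrite e modnn in hb].
by rewrite -natr1; lra.
Qed.

(** The number of solutions is read off the measure of one cell of rank [k], viewed as a union of
    cells of rank [J]. *)
Lemma sum_residue (J k n c : nat) : (k <= J)%N ->
  \sum_(u < 2 ^ J) (u + n == c %[mod 2 ^ k])%:R = 2 ^+ J * (2 ^+ k)^-1 :> R.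
Proof.
move=> kJ.
have p0 : (0 < 2 ^ k)%N by rewrite expn_gt0.
(* [i0] is the residue of [c - n], written so as to avoid truncated subtraction. *)
pose i0 := ((c + (2 ^ k - n %% 2 ^ k)) %% 2 ^ k)%N.
have hi0 : (i0 < 2 ^ k)%N by rewrite ltn_pmod.
have nk := ltn_pmod n p0.
have hitE u : ((u + n == c %[mod 2 ^ k]) = (u %% 2 ^ k == i0))%N.
  rewrite -(eqn_modDr (2 ^ k - n %% 2 ^ k)%N) -addnA.
  have -> : (n + (2 ^ k - n %% 2 ^ k) = (n %/ 2 ^ k).+1 * 2 ^ k)%N.
    by rewrite {1}(divn_eq n (2 ^ k)) mulSn; lia.
  by rewrite (addnC u) modnMDl.
have <- : mu (dyset J (fun u => u %% 2 ^ k == i0)%N) = (2 ^+ k)^-1 :> R.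
  rewrite -(mu_cell hi0); congr mu; apply/seteqP; split=> x [Ix] /=;
  by rewrite /(dyset _ _) /= (address_mod _ kJ).
rewrite mu_dyset mulrC divfK ?expf_neq0// -sum1_card natr_sum [RHS]big_mkcond /=.
by apply: eq_bigr => u _; rewrite hitE !inE; case: ifP.
Qed.

Variables (k : nat -> nat) (c : nat).
Hypothesis k_mono : forall i j, (i <= j)%N -> (k i <= k j)%N.

(** For fine enough addresses [u] of a point and [c] of the centre, the [n]-th odometer iterate of
    the point shares the cell of rank [k n] with the centre. *)
Definition hit (n u : nat) : bool := (u + n == c %[mod 2 ^ k n])%N.

(** For [u] uniform below [2 ^ J] with [J] large, [w n] is the probability of a hit at time [n],
    [S N d] counts the hits at the [d] times from [N] on, and [E N d] is its mean. *)
Let w (n : nat) : R := (2 ^+ k n)^-1.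
Let E (N d : nat) : R := \sum_(i < d) w (N + i).
Let S (N d u : nat) : R := \sum_(i < d) (hit (N + i) u)%:R.

Let w_ge0 n : 0 <= w n. Proof. exact: ltW (exp2V_gt0 _). Qed.
Let E_ge0 N d : 0 <= E N d. Proof. exact: sumr_ge0. Qed.

Let ES N d : E N d.+1 = w N + E N.+1 d.
Proof.
rewrite /E big_ord_recl addn0; congr (_ + _).
by apply: eq_bigr => i _; rewrite /bump /= addnA addn1.
Qed.

Let SS N d u : S N d.+1 u = (hit N u)%:R + S N.+1 d u.
Proof.
rewrite /S big_ord_recl addn0; congr (_ + _).
by apply: eq_bigr => i _; rewrite /bump /= addnA addn1.
Qed.

Lemma sum_hit J n : (k n <= J)%N -> \sum_(u < 2 ^ J) (hit n u)%:R = 2 ^+ J * w n.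
Proof. exact: sum_residue. Qed.

(** A hit at [n'] is also a congruence modulo the smaller [2 ^ k n], so a double hit forces
    [2 ^ k n] to divide [n' - n]; in that case the first factor is bounded by 1. *)
Lemma sum_hit2 J n n' : (n <= n')%N -> (k n' <= J)%N ->
  \sum_(u < 2 ^ J) (hit n u)%:R * (hit n' u)%:R <=
  (2 ^ k n %| n' - n)%:R * (2 ^+ J * w n').
Proof.
move=> nn' kJ; case: (boolP (2 ^ k n %| n' - n)%N) => h.
  rewrite mul1r -sum_hit//; apply: ler_sum => u _.
  by case: (hit n u); rewrite ?mul1r ?mul0r.
rewrite mul0r big1// => u _.
case: (boolP (hit n u)) => h1; rewrite ?mul0r// mul1r.
case: (boolP (hit n' u)) => h2 //; case/negP: h.
have dv : (2 ^ k n %| 2 ^ k n')%N by rewrite dvdn_exp2l// k_mono.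
have h3 : (u + n' == c %[mod 2 ^ k n])%N.
  move: h2; rewrite /hit => /eqP h2.
  by rewrite -(modn_dvdm _ dv) h2 modn_dvdm.
move: h1; rewrite /hit -(eqP h3) -(subnKC nn') addnA -{1}(addn0 (u + n)%N) eqn_modDl.
by rewrite mod0n eq_sym addKn.
Qed.

(** Double hits occur only along multiples of [2 ^ k N], the inverse of [w N], so [sum_multiples_le]
    bounds the cross term by the product of the means. *)
Lemma sum_hit_S J N d : (forall i, (i < d)%N -> (k (N.+1 + i) <= J)%N) ->
  \sum_(u < 2 ^ J) (hit N u)%:R * S N.+1 d u <= 2 ^+ J * (w N * E N.+1 d).
Proof.
move=> kJ; under eq_bigr do rewrite /S mulr_sumr.
rewrite exchange_big /=.
apply: (@le_trans _ _ (\sum_(i < d) (2 ^ k N %| i.+1)%:R * (2 ^+ J * w (N + i.+1)))).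
  apply: ler_sum => i _; rewrite (_ : N + i.+1 = N.+1 + i)%N; last by lia.
  rewrite [X in (_ %| X)%N](_ : _ = N.+1 + i - N)%N; last by lia.
  by apply: sum_hit2; [lia|exact: kJ].
have p0 : (0 < 2 ^ k N)%N by rewrite expn_gt0.
have h := @sum_multiples_le w (2 ^ k N) N d p0 w_ge0
  (fun i j ij => exp2V_le (k_mono ij)).
have -> : \sum_(i < d) (2 ^ k N %| i.+1)%:R * (2 ^+ J * w (N + i.+1)) =
   2 ^+ J * \sum_(i < d) (2 ^ k N %| i.+1)%:R * w (N + i.+1).
  by rewrite mulr_sumr; apply: eq_bigr => i _; rewrite mulrCA.
apply: ler_wpM2l; first exact: exprn_ge0.
have -> : E N.+1 d = \sum_(j < d) w (N + j.+1).
  by apply: eq_bigr => i _; rewrite addnS.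
by rewrite mulrC ler_pdivlMr ?exprn_gt0// mulrC -natrX.
Qed.

Lemma sum_S J N d : (forall i, (i < d)%N -> (k (N + i) <= J)%N) ->
  \sum_(u < 2 ^ J) S N d u = 2 ^+ J * E N d.
Proof.
move=> kJ; rewrite /S exchange_big /= /E mulr_sumr.
by apply: eq_bigr => i _; rewrite sum_hit//; exact: kJ.
Qed.

(** Variance at most the mean. Splitting off the first time, its indicator equals its own square and
    the cross term is [sum_hit_S]. *)
Lemma second_moment J N d : (forall i, (i < d)%N -> (k (N + i) <= J)%N) ->
  \sum_(u < 2 ^ J) S N d u ^+ 2 <= 2 ^+ J * (E N d ^+ 2 + E N d).
Proof.
elim: d N => [|d IH] N kJ.
  by rewrite /E big_ord0 expr0n addr0 mulr0 big1// => u _; rewrite /S big_ord0 expr0n.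
have kJ' i : (i < d)%N -> (k (N.+1 + i) <= J)%N.
  by move=> id; rewrite addSn -addnS; exact: kJ.
have -> : \sum_(u < 2 ^ J) S N d.+1 u ^+ 2 = \sum_(u < 2 ^ J) (hit N u)%:R +
    (\sum_(u < 2 ^ J) (hit N u)%:R * S N.+1 d u) *+ 2 + \sum_(u < 2 ^ J) S N.+1 d u ^+ 2.
  rewrite -sumrMnl -!big_split /=; apply: eq_bigr => u _; rewrite SS.
  by case: (hit N u) => /=; ring.
rewrite sum_hit; last by rewrite -(addn0 N); exact: kJ.
have h1 := sum_hit_S kJ'; have h2 := IH _ kJ'.
have p0 : 0 <= (2 ^+ J : R) by exact: exprn_ge0.
rewrite ES; set e := E N.+1 d in h1 h2 *.
have h3 : 2 ^+ J * (w N * e *+ 2) + 2 ^+ J * w N + 2 ^+ J * (e ^+ 2 + e) <=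
    2 ^+ J * ((w N + e) ^+ 2 + (w N + e)).
  rewrite -!mulrDr; apply: ler_wpM2l => //.
  have : 0 <= w N ^+ 2 by exact: sqr_ge0.
  by lra.
by move: h1; rewrite mulr2n mulrnAr -mulr_natl in h3 *; lra.
Qed.

(** Chebyshev's inequality: without a hit, the squared deviation from the mean is [E N d ^+ 2]. *)
Lemma card_no_hit J N d : (forall i, (i < d)%N -> (k (N + i) <= J)%N) ->
  #|[pred u : 'I_(2 ^ J) | [forall i : 'I_d, ~~ hit (N + i) u]]|%:R * E N d ^+ 2
    <= 2 ^+ J * E N d.
Proof.
move=> kJ; have h1 := sum_S kJ; have h2 := second_moment kJ.
set e := E N d in h1 h2 *.
apply: (@le_trans _ _ (\sum_(u < 2 ^ J) (S N d u - e) ^+ 2)).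
  rewrite -sum1_card natr_sum big_mkcond mulr_suml; apply: ler_sum => u _.
  case: ifP; rewrite ?mul0r ?sqr_ge0// inE => /forallP nh.
  rewrite /S big1 ?sub0r ?sqrrN ?mul1r// => i _.
  by rewrite (negbTE (nh i)).
have -> : \sum_(u < 2 ^ J) (S N d u - e) ^+ 2 =
   \sum_(u < 2 ^ J) S N d u ^+ 2 - (\sum_(u < 2 ^ J) S N d u) * (e *+ 2) + 2 ^+ J * e ^+ 2.
  have -> : 2 ^+ J * e ^+ 2 = \sum_(u < 2 ^ J) e ^+ 2.
    by rewrite sumr_const card_ord -[RHS]mulr_natl natrX.
  rewrite mulr_suml -sumrB -big_split /=; apply: eq_bigr => u _.
  by ring.
by rewrite h1; lra.
Qed.

End SecondMoment.

(** * Almost sure hitting by the odometer *)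

Section HitAlmostSurely.
Context {R : realType}.
Local Notation I01 := (@I01 R).
Local Notation dyset := (@dyset R).
Local Notation address := (@address R).
Hint Resolve measurable_I01 measurable_dyset : core.

(** Points outside the union have no hit at the [d] times from [N] on, which by [card_no_hit] has
    probability at most [1 / E]; divergence makes this smaller than [1 - mu V]. *)
Lemma mu_hit_io (k : nat -> nat) (y : R) (N : nat) :
  (forall i j, (i <= j)%N -> (k i <= k j)%N) ->
  (forall M : R, exists d, M < \sum_(i < d) (2 ^+ k (N + i)%N)^-1) ->
  mu (\bigcup_(n in [set n | (N <= n)%N])
    dyset (k n) (fun u => u + n == address (k n) y %[mod 2 ^ k n])%N) = 1.
Proof.
move=> kmono kdiv; set V := \bigcup_(n in _) _.
have mV : measurable V by apply: bigcup_measurable => n _; exact: measurable_dyset.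
apply/eqP; rewrite eq_le mu_le1//= leNgt; apply/negP => hV.
have e0 : 0 < 1 - mu V by lra.
have [d hd] := kdiv (1 - mu V)^-1.
set E := \sum_(i < d) _ in hd.
have E0 : 0 < E by apply: lt_trans hd; rewrite invr_gt0.
(* [J] is at least as fine as every rank met, so the single address [c] determines all the
   targets. *)
pose J := k (N + d)%N; pose c := address J y.
have kJ i : (i < d)%N -> (k (N + i) <= J)%N by move=> id; apply: kmono; lia.
have hitE i u : (k i <= J)%N -> (u %% 2 ^ k i + i == address (k i) y %[mod 2 ^ k i])%N = hit k c i u.
  by move=> ki; rewrite /hit modnDml (address_mod y ki) modn_mod.
have := @card_no_hit R k c kmono J N d kJ; rewrite -/E.
set P := [pred u : 'I_(2 ^ J) | _] => hP.
pose Q (u : nat) := [forall i : 'I_d, ~~ hit k c (N + i) u].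
have hQ : mu (dyset J Q) * E <= 1.
  have p0 : 0 < 2 ^+ J * E by rewrite mulr_gt0// exprn_gt0.
  rewrite -(ler_pM2r p0) mu_dyset mul1r; apply: le_trans hP.
  rewrite (_ : P = [pred i : 'I_(2 ^ J) | Q i])//.
  by rewrite le_eqVlt; apply/orP; left; apply/eqP; field; rewrite expf_neq0.
have hsum : 1 <= mu V + mu (dyset J Q).
  rewrite -mu_I01; apply: muU_le => // x [Ix _].
  have [[n Nn xn]|nV] := pselect (V x); first by left; exists n.
  right; split=> //; apply/forallP => i; apply/negP => hi; apply: nV.
  exists (N + i)%N; first by rewrite /= leq_addr.
  split=> //; have ki := kJ i (ltn_ord i).
  by rewrite (address_mod x ki) /= hitE.
have : (1 - mu V)^-1 * (1 - mu V) < E * (1 - mu V) by rewrite ltr_pM2r.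
rewrite mulVf ?gt_eqF// => h1.
have : (1 - mu V) * E <= mu (dyset J Q) * E by rewrite ler_pM2r//; lra.
by rewrite mulrC; lra.
Qed.

End HitAlmostSurely.

(** * Cyclic permutations of cells *)

Section Permutations.
Local Open Scope nat_scope.

Lemma card_pred_perm (T : finType) (s : {perm T}) (P : pred T) :
  #|[pred u | P (s u)]| = #|[pred u | P u]|.
Proof. by rewrite -!sum1_card [RHS](reindex_inj (@perm_inj _ s)). Qed.

(** The transposition only permutes the mismatches, so cycles meeting a common label can be merged
    at no cost. *)
Lemma tpermM_fails (T L : finType) (g0 d : T -> L) (s : {perm T}) x y : d x = d y ->
  #|[pred u | g0 ((tperm x y * s)%g u) != d u]| = #|[pred u | g0 (s u) != d u]|.
Proof.
move=> dxy; rewrite -(card_pred_perm (tperm x y)).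
by apply: eq_card => u; rewrite !inE permM tpermK; case: tpermP => [->|->|] //; rewrite dxy.
Qed.

(** A transposition of points in two different cycles joins the cycles and changes the permutation
    at two points only. *)
Lemma merge_porbits (T : finType) (s : {perm T}) : 0 < #|T| ->
  exists2 c : {perm T}, #|porbits c| <= 1 &
    #|[pred x | c x != s x]| <= 2 * #|porbits s|.
Proof.
move=> T0; have [n] := ubnP #|porbits s|; elim: n s => // n IH s hs.
case: (leqP #|porbits s| 1) => h1.
  exists s => //; have -> // : #|[pred x | s x != s x]| = 0.
  by apply: eq_card0 => x; rewrite !inE eqxx.
have [x [y xy]] : exists x y, x \notin porbit s y.
  apply: contrapT => hn; move: h1; rewrite ltnNge; case/negP.
  have /card_gt0P[x0 _] := T0.
  rewrite -(cards1 (porbit s x0)); apply: subset_leq_card.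
  apply/fintype.subsetP => A /imsetP[y _ ->]; rewrite inE eq_porbit_mem.
  by apply/negPn/negP => h; apply: hn; exists y, x0.
have xney : x != y by apply: contraNneq xy => ->; exact: porbit_id.
have := porbits_mul_tperm s x y => /=; rewrite xy xney /= => e.
have [|c c1 hc] := IH (tperm x y * s)%g; first by move: e hs; do 2![move: #|porbits _|]; lia.
exists c => //.
apply: (@leq_trans (#|[pred z | c z != (tperm x y * s)%g z]| + #|[set x; y]%SET|)).
  rewrite -cardUI; apply: leq_trans (leq_addr _ _).
  apply: subset_leq_card; apply/fintype.subsetP => z; rewrite !inE => h.
  case: (eqVneq z x) => [->|zx]; first by rewrite orbT.
  case: (eqVneq z y) => [->|zy]; first by rewrite !orbT.
  by rewrite permM tpermD ?h// eq_sym.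
by rewrite cards2 xney; move: e hc; do 2![move: #|porbits _|] => *; lia.
Qed.

(** Each cycle is determined by the label of any of its points. *)
Lemma card_porbits_le (T L : finType) (d : T -> L) (s : {perm T}) :
  (forall x y, d x = d y -> x \in porbit s y) -> #|porbits s| <= #|L|.
Proof.
move=> h.
pose rep l := if [pick x | d x == l] is Some x then porbit s x else finset.set0.
apply: leq_trans (_ : #|finset.imset rep (mem L)| <= _); last exact: leq_imset_card.
apply: subset_leq_card; apply/fintype.subsetP => A /imsetP[x _ ->].
apply/imsetP; exists (d x) => //; rewrite /rep; case: pickP => [y /eqP e|/(_ x)].
  by apply/eqP; rewrite eq_porbit_mem h.
by rewrite eqxx.
Qed.

(* A permutation minimizing lexicographically the number of mismatches and
   the number of cycles does the job: otherwise compose it with a transposition. *)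
Lemma exists_label_perm (T L : finType) (g0 d : T -> L) :
  exists2 s : {perm T}, #|porbits s| <= #|L| &
    #|[pred u | g0 (s u) != d u]| <=
      \sum_(j : L) (#|[pred u | d u == j]| - #|[pred u | g0 u == j]|).
Proof.
pose fails (s : {perm T}) := #|[pred u | g0 (s u) != d u]|.
(* The factor exceeds any number of cycles, so costs compare lexicographically. *)
pose cost s := fails s * #|T|.+1 + #|porbits s|.
have [s _ smin] := @arg_minnP _ 1%g predT cost isT.
have porb (t : {perm T}) : #|porbits t| <= #|T| by exact: leq_imset_card.
exists s.
  apply: (@card_porbits_le _ _ d) => x y dxy; apply/negPn/negP => xy.
  have xney : x != y by apply: contraNneq xy => ->; exact: porbit_id.
  have := porbits_mul_tperm s x y => /=; rewrite xy xney /= => e.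
  have := smin (tperm x y * s)%g isT.
  rewrite /cost /fails tpermM_fails// leq_add2l.
  by move: e; do 2![move: #|porbits _|] => *; lia.
rewrite -sum1_card (partition_big d predT) //=; apply: leq_sum => j _.
rewrite sum1_card -/(fails s).
case: (pickP [pred u | (g0 (s u) != d u) && (d u == j)]) => [u /andP[fu /eqP du]|none]; last first.
  by rewrite eq_card0.
(* Otherwise swapping [u'] with the mismatched [u] would repair [u] without creating a mismatch. *)
have good u' : g0 (s u') = j -> d u' = j.
  move=> gj; apply/eqP/negPn/negP => du'.
  have uu' : u != u' by apply: contraNneq du' => <-; rewrite du.
  have : fails (tperm u u' * s)%g < fails s.
    apply: proper_card; apply/fintype.properP; split; last first.
      by exists u => //; rewrite inE permM tpermL gj du eqxx.
    apply/fintype.subsetP => z; rewrite !inE permM; case: tpermP => [->|->|//].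
      by rewrite gj du eqxx.
    by move=> _; rewrite gj eq_sym du'.
  have := smin (tperm u u' * s)%g isT; rewrite /cost.
  have := porb (tperm u u' * s)%g; have := porb s.
  by do 2![move: #|porbits _|] => *; nia.
(* The positions labelled [j] contain, disjointly, the mismatched ones and all those that [s] sends
   to value [j] under [g0]. *)
rewrite leq_subRL; last first.
  rewrite -(card_pred_perm s [pred u | g0 u == j]); apply: subset_leq_card.
  by apply/fintype.subsetP => z; rewrite !inE => /eqP/good ->.
rewrite -(card_pred_perm s [pred u | g0 u == j]) -cardUI.
rewrite [X in _ + X]eq_card0 ?addn0; last first.
  move=> z; rewrite !inE; apply/negP => /andP[/eqP gz /andP[+ dz]].
  by rewrite inE gz (good _ gz) eqxx.
apply: subset_leq_card; apply/fintype.subsetP => z; rewrite !inE => /orP[/eqP/good ->//|].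
by case/andP.
Qed.

(** Points are numbered by their position along the single cycle, starting from 0. *)
Lemma cyclic_perm_conj n (c : {perm 'I_n}) : 0 < n -> #|porbits c| <= 1 ->
  exists f g : nat -> nat, [/\ forall i, i < n -> f i < n, forall i, i < n -> g i < n,
    forall i, i < n -> g (f i) = i, forall i, i < n -> f (g i) = i &
    forall u : 'I_n, f (c u) = (f u + 1) %% n].
Proof.
move=> n0 c1; pose u0 := Ordinal n0.
have fc u : fconnect c u0 u.
  have : u \in porbit c u0.
    by rewrite -eq_porbit_mem; apply/eqP/(card_le1_eqP c1); exact: imset_f.
  by case/porbitP => i ->; rewrite permX fconnect_iter.
have on : fingraph.order c u0 = n.
  by rewrite /fingraph.order -[RHS]card_ord; apply: eq_card => u; rewrite !inE fc.
have fl u : findex c u0 u < n by rewrite -[X in _ < X]on; exact: findex_max.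
pose f i := if insub i is Some u then findex c u0 u else 0.
pose g i : nat := iter i c u0.
have fE (u : 'I_n) : f u = findex c u0 u.
  by rewrite /f insubT//= => h; congr findex; apply: val_inj.
exists f, g; split=> [i hi|i hi|i hi|i hi|u].
- by rewrite -[i]/(val (Ordinal hi)) fE.
- exact: ltn_ord.
- by rewrite /g -[i in f i]/(val (Ordinal hi)) fE iter_findex.
- by rewrite /g fE findex_iter// on.
- rewrite !fE -{1}(iter_findex (fc u)) -iterS.
  have := fl u; rewrite leq_eqVlt => /orP[/eqP e|h].
    have -> : iter (findex c u0 u).+1 c u0 = u0.
      by rewrite e -[X in iter X]on iter_order//; exact: perm_inj.
    by rewrite findex0 addn1 e modnn.
  by rewrite findex_iter ?on// addn1 modn_small.
Qed.

End Permutations.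

(** * Permutations of dyadic cells by translations *)

Section Relabel.
Context {R : realType}.
Local Notation I01 := (@I01 R).
Local Notation dyset := (@dyset R).
Local Notation address := (@address R).
Local Notation doubling := (@doubling R).
Local Notation cellpt := (@cellpt R).
Hint Resolve measurable_I01 measurable_dyset : core.

Definition relabel r (f : nat -> nat) (x : R) : R :=
  cellpt r (f (address r x)) (iter r doubling x).

Variables (r : nat) (f g : nat -> nat).
Hypothesis f_lt : forall i, (i < 2 ^ r)%N -> (f i < 2 ^ r)%N.
Hypothesis g_lt : forall i, (i < 2 ^ r)%N -> (g i < 2 ^ r)%N.
Hypothesis fK : forall i, (i < 2 ^ r)%N -> g (f i) = i.
Hypothesis gK : forall i, (i < 2 ^ r)%N -> f (g i) = i.

Lemma relabel_I01 x : I01 x -> I01 (relabel r f x).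
Proof. by move=> Ix; apply: cellpt_I01; exact: iter_doubling_I01. Qed.

Lemma address_relabel x : I01 x -> address r (relabel r f x) = f (address r x).
Proof.
by move=> Ix; rewrite address_cellpt ?f_lt ?address_lt//; exact: iter_doubling_I01.
Qed.

(** Only the first [r] digits change, and the new ones depend on the old ones alone. *)
Lemma address_relabel_eq s x y : (r <= s)%N -> I01 x -> I01 y ->
  address s x = address s y -> address s (relabel r f x) = address s (relabel r f y).
Proof.
move=> rs Ix Iy e; have e1 := address_le_eq rs e.
move: e; rewrite -(subnKC rs) !addressD !address_relabel//.
rewrite !iter_doubling_cellpt; [|exact: iter_doubling_I01..].
by rewrite e1 => /addnI/eqP; rewrite eqn_pmul2l ?expn_gt0// => /eqP ->.
Qed.

Lemma relabelK x : I01 x -> relabel r g (relabel r f x) = x.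
Proof.
move=> Ix; rewrite {1}/relabel address_relabel// fK ?address_lt//.
by rewrite iter_doubling_cellpt ?cellpt_address//; exact: iter_doubling_I01.
Qed.

End Relabel.

Section RelabelM.
Context {R : realType}.

Lemma relabel_inM r (f g : nat -> nat) :
  (forall i, (i < 2 ^ r)%N -> (f i < 2 ^ r)%N) ->
  (forall i, (i < 2 ^ r)%N -> (g i < 2 ^ r)%N) ->
  (forall i, (i < 2 ^ r)%N -> g (f i) = i) ->
  (forall i, (i < 2 ^ r)%N -> f (g i) = i) -> inM (@relabel R r f).
Proof.
move=> f_lt g_lt fK gK.
apply: (@inM_piecewise_translation _ _ (fun i => dyset r (pred1 i))
  (fun i => cellpt r (f i) 0 - cellpt r i 0)).
- split=> [x Ix|x y|y Iy].
  + exact: relabel_I01.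
  + by rewrite !inE => Ix Iy e; rewrite -(relabelK f_lt fK Ix) e relabelK.
  + by exists (relabel r g y); [exact: relabel_I01|rewrite relabelK].
- by move=> i; exact: measurable_dyset.
- by move=> x Ix; exists (address r x); split => //=.
- move=> i x Ix [_ /eqP e].
  rewrite -[X in _ = X + _](cellpt_address r x) /relabel e.
  rewrite (cellpt_affine _ (f i)) (cellpt_affine _ i (iter _ _ _)).
  by rewrite [RHS]addrC addrA subrK.
Qed.

End RelabelM.

(** * Weak approximation by conjugates of the odometer *)

Section Approximation.
Context {R : realType}.
Local Notation I01 := (@I01 R).
Local Notation dyset := (@dyset R).
Local Notation address := (@address R).
Hint Resolve measurable_I01 measurable_dyset : core.

Lemma dyset_approx_fin (A : nat -> set R) k (e : R) :
  (forall i, (i < k)%N -> measurable (A i)) -> 0 < e ->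
  exists r0, forall r, (r0 <= r)%N -> forall i, (i < k)%N ->
    exists P : pred nat, mu (symdiff (A i) (dyset r P)) < e.
Proof.
move=> mA e0; elim: k mA => [|k IH] mA; first by exists 0%N.
have [|r1 h1] := IH; first by move=> i ik; apply: mA; rewrite ltnS ltnW.
have [r2 h2] := dyset_approx (mA k (ltnSn k)) e0.
exists (maxn r1 r2) => r; rewrite geq_max => /andP[r1r r2r] i.
rewrite ltnS leq_eqVlt => /predU1P[->|ik]; [exact: h2|exact: h1].
Qed.

(** With [g] inverse to [f], this is the odometer conjugated by a permutation of the cells of rank
    [r]. *)
Definition conj_odo r (f g : nat -> nat) : R -> R :=
  relabel r g \o (odo \o relabel r f).

Variables (r : nat) (f g : nat -> nat).
Hypothesis f_lt : forall i, (i < 2 ^ r)%N -> (f i < 2 ^ r)%N.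
Hypothesis g_lt : forall i, (i < 2 ^ r)%N -> (g i < 2 ^ r)%N.
Hypothesis fK : forall i, (i < 2 ^ r)%N -> g (f i) = i.
Hypothesis gK : forall i, (i < 2 ^ r)%N -> f (g i) = i.

Lemma conj_odo_inM : inM (conj_odo r f g).
Proof.
apply: inM_comp; first exact: (relabel_inM g_lt f_lt).
by apply: inM_comp; [exact: odo_inM|exact: (relabel_inM f_lt g_lt)].
Qed.

Definition conj_orbit0 : set R := relabel r f @^-1` orbit0 `&` I01.

Lemma conj_orbit0P : measurable conj_orbit0 /\ mu conj_orbit0 = 0.
Proof.
have [h1 h2] := inM_preimage (relabel_inM f_lt g_lt fK gK) (@measurable_orbit0 R).
by split=> //; rewrite -(@mu_orbit0 R).
Qed.

Lemma iter_conj_odo n x : I01 x ->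
  iter n (conj_odo r f g) x = relabel r g (iter n odo (relabel r f x)).
Proof.
move=> Ix; elim: n => [|n IH] /=; first by rewrite relabelK.
rewrite IH /conj_odo /= relabelK//.
by apply: inM_maps (inM_iter n odo_inM) _; exact: relabel_I01.
Qed.

Lemma address_conj_odo x : I01 x -> ~ conj_orbit0 x ->
  address r (conj_odo r f g x) = g ((f (address r x) + 1) %% 2 ^ r)%N.
Proof.
move=> Ix nx; have If : I01 (relabel r f x) by exact: relabel_I01.
rewrite /conj_odo /= address_relabel//; last exact: inM_maps odo_inM _.
rewrite odoE; last by move=> h; apply: nx.
by rewrite address_odo_map// address_relabel.
Qed.

(** Relabelling maps an invariant set of the conjugate to an invariant set of the odometer of the
    same measure. *)
Lemma conj_odo_ergodic : ergodic (conj_odo r f g).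
Proof.
move=> A mA AI inv.
have fM : inM (@relabel R r f) := relabel_inM f_lt g_lt fK gK.
have [mfA fAI efA] := inM_image fM mA AI.
have [] := odo_ergodic mfA fAI; last 2 first.
- by rewrite m_muS// efA -m_muS//; left.
- by rewrite m_muS// efA -m_muS//; right.
have sigA x : I01 x -> A (conj_odo r f g x) <-> A x.
  by move=> Ix; split=> [h|]; [rewrite -inv|rewrite -{1}inv => -[]].
have fA x : I01 x -> (relabel r f @` A) (relabel r f x) <-> A x.
  move=> Ix; split=> [[z Az /(inM_inj fM (AI z Az) Ix) <-]//|Ax].
  by exists x.
apply/seteqP; split=> [y [/= Ay Iy]|_ [x Ax <-]].
  have [x Ix xy] := inM_surj fM Iy; rewrite -xy in Ay *.
  apply/(fA x Ix)/(sigA x Ix); apply/(fA _ (inM_maps conj_odo_inM Ix)).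
  by rewrite /conj_odo /= (relabelK g_lt gK)//; apply: inM_maps odo_inM _; exact: relabel_I01.
have Ix := AI x Ax; split; last exact: relabel_I01.
suff: (relabel r f @` A) (odo (relabel r f x)) by [].
have -> : odo (relabel r f x) = relabel r f (conj_odo r f g x).
  by rewrite /conj_odo /= (relabelK g_lt gK)//; apply: inM_maps odo_inM _; exact: relabel_I01.
by apply/(fA _ (inM_maps conj_odo_inM Ix))/(sigA x Ix).
Qed.

End Approximation.

Section WeakApproximation.
Context {R : realType}.
Local Notation I01 := (@I01 R).
Local Notation dyset := (@dyset R).
Local Notation address := (@address R).
Hint Resolve measurable_I01 measurable_dyset : core.

(** A fine cell [u] carries two labels: the coarse cell [d u] containing it, and the coarse cell
    [g0 u] whose image under [tau] it approximates. A cyclic permutation sending most cells to cells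
    with [g0] equal to their own [d] follows [tau] on coarse cells. *)
Lemma weak_approximation (tau : R -> R) (As : nat -> set R) k (e : R) : inM tau ->
  (forall i, (i < k)%N -> measurable (As i) /\ As i `<=` I01) -> 0 < e ->
  exists r (f g : nat -> nat),
  [/\ forall i, (i < 2 ^ r)%N -> (f i < 2 ^ r)%N,
      forall i, (i < 2 ^ r)%N -> (g i < 2 ^ r)%N,
      forall i, (i < 2 ^ r)%N -> g (f i) = i,
      forall i, (i < 2 ^ r)%N -> f (g i) = i &
      forall i, (i < k)%N ->
        mu (symdiff (conj_odo r f g @` As i) (tau @` As i)) < e].
Proof.
move=> tM mAs e0.
have e80 : 0 < e / 8 by lra.
have [k0 /(_ k0 (leqnn _)) hQ] := @dyset_approx_fin R As k _ (fun i ik => (mAs i ik).1) e80.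
pose L := (2 ^ k0)%N; have L0 : (0 < L)%N by rewrite expn_gt0.
have L0' : 0 < L%:R :> R by rewrite ltr0n.
pose F j := tau @` dyset k0 (pred1 j).
have mF j : measurable (F j).
  by have [] := inM_image tM (measurable_dyset k0 (pred1 j)) (fun x => @proj1 _ _).
have muF j : (j < L)%N -> mu (F j) = L%:R^-1.
  move=> jL; have [_ _ ->] := inM_image tM (measurable_dyset k0 (pred1 j)) (fun x => @proj1 _ _).
  by rewrite mu_cell// natrX.
(* Two divisions by [L]: one for the sum over the [L] sets making up [bad], one because [bad] is
   charged once for each of the [L] labels. *)
pose delta : R := e / 8 / L%:R / L%:R.
have d0 : 0 < delta by rewrite !divr_gt0.
have [r1 hr1] := @dyset_approx_fin R F L delta (fun j _ => mF j) d0.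
(* Merging cycles will alter at most [2 * L] cells; this rank makes their total measure less than
   [e / 8]. *)
have [r2 hr2] := @exp2_small R (e / 8 / (2 * L%:R)) ltac:(by rewrite !divr_gt0 ?mulr_gt0).
pose r := maxn k0 (maxn r1 r2).
have k0r : (k0 <= r)%N by rewrite leq_max leqnn.
have r1r : (r1 <= r)%N by rewrite !leq_max leqnn orbT.
have small : 2 * L%:R / 2 ^+ r < e / 8 :> R.
  have : (2 ^+ r)^-1 < e / 8 / (2 * L%:R) :> R.
    by apply: le_lt_trans hr2; apply: exp2V_le; rewrite !leq_max leqnn !orbT.
  by rewrite ltr_pdivlMr ?mulr_gt0// mulrC.
have [P hP] : exists P : nat -> pred nat, forall j, (j < L)%N ->
    mu (symdiff (F j) (dyset r (P j))) < delta.
  have /choice[P hP] : forall j, exists Pj : pred nat, (j < L)%N ->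
      mu (symdiff (F j) (dyset r Pj)) < delta.
    move=> j; case: (ltnP j L) => jL; last by exists pred0.
    by have [Pj h] := hr1 r r1r j jL; exists Pj.
  by exists P.
pose bad := \bigcup_(j in [set j | (j < L)%N]) symdiff (F j) (dyset r (P j)).
have mbad : measurable bad.
  by apply: bigcup_measurable => j _; exact: measurable_symdiff.
have mubad : mu bad <= e / 8 / L%:R.
  apply: (@le_trans _ _ (\sum_(j < L) mu (symdiff (F j) (dyset r (P j))))).
    apply: (@mu_sum_le _ L (fun j => symdiff (F j) (dyset r (P j)))) => //.
      by move=> j _; exact: measurable_symdiff (mF j) (measurable_dyset _ _).
  apply: (@le_trans _ _ (\sum_(j < L) delta)).
    by apply: ler_sum => j _; exact/ltW/hP.
  by rewrite sumr_const card_ord -(mulr_natr delta L) divfK// gt_eqF.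
pose j0 := Ordinal L0.
(* A cell with no candidate [j], which gets the default [j0], lies in [bad], since the sets [F j]
   cover [I01]. *)
pose g0 (u : 'I_(2 ^ r)) : 'I_L := odflt j0 [pick j : 'I_L | P j u].
pose d (u : 'I_(2 ^ r)) : 'I_L := Ordinal (ltn_pmod u L0).
have tinj j j' y : F j y -> F j' y -> j = j'.
  move=> [x [Ix /eqP <-] <-] [x' [Ix' /eqP <-]] /(inM_inj tM Ix' Ix) ->.
  by [].
have lab y (yr : (address r y < 2 ^ r)%N) (j : 'I_L) : I01 y -> ~ bad y -> F j y ->
    g0 (Ordinal yr) = j.
  move=> Iy nbad Fy.
  have Pj : P j (address r y).
    apply: contrapT => nP; apply: nbad; exists j; first exact: ltn_ord.
    by left; split=> // -[].
  rewrite /g0; case: pickP => [j' /= Pj'|/(_ j)]; last by rewrite /= Pj.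
  apply: contrapT => jj'; apply: nbad; exists j'; first exact: ltn_ord.
  right; split=> // Fj'; apply: jj'; apply: val_inj; exact: tinj Fj' Fy.
have [s s_porb s_fail] := exists_label_perm g0 d.
have pr0 : (0 < 2 ^ r)%N by rewrite expn_gt0.
have [|c c1 cs] := merge_porbits s; first by rewrite card_ord.
have [f [g [f_lt g_lt fK gK fc]]] := cyclic_perm_conj pr0 c1.
exists r, f, g; split=> //.
have sM : inM (@conj_odo R r f g) by exact: conj_odo_inM f_lt g_lt fK gK.
pose sigma : R -> R := conj_odo r f g; rewrite -/sigma in sM *.
pose N : set R := @conj_orbit0 R r f.
have [mN N0] : measurable N /\ mu N = 0 := conj_orbit0P f_lt g_lt fK gK.
(* The cells on which the cyclic permutation misses the wanted label. *)
pose fl u : bool := if insub u is Some v then g0 (c v) != d v else false.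
have flE (v : 'I_(2 ^ r)) : fl v = (g0 (c v) != d v).
  rewrite /fl insubT//= => h; congr (g0 (c _) != d _); exact: val_inj.
pose W : set R := dyset r fl.
have p2 : 0 < 2 ^+ r :> R by rewrite exprn_gt0.
have p20 : 2 ^+ r != 0 :> R by rewrite gt_eqF.
have muW : mu W <= e / 4.
  rewrite /W mu_dyset.
  have h1 : (#|[pred i : 'I_(2 ^ r) | fl i]| <=
     \sum_(j < L) (#|[pred u | d u == j]| - #|[pred u | g0 u == j]|) + 2 * L)%N.
    apply: (@leq_trans (#|[pred u | g0 (s u) != d u]| + #|[pred x | c x != s x]|)%N).
      rewrite -cardUI; apply: leq_trans (leq_addr _ _).
      apply: subset_leq_card; apply/fintype.subsetP => u; rewrite !inE flE.
      by case: (eqVneq (c u) (s u)) => [->|_ _]; rewrite ?orbF ?orbT.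
    by apply: leq_add => //; apply: leq_trans cs _; rewrite leq_mul2l -[X in (_ <= X)%N]card_ord.
  (* A shortage of label [j] comes from [bad] only: off it, the points of [F j] lie in cells
     labelled [j] by [g0]. *)
  have h2 (j : 'I_L) : (#|[pred u | d u == j]| - #|[pred u | g0 u == j]|)%:R / 2 ^+ r
      <= mu bad.
    have e1 : #|[pred u | d u == j]|%:R / 2 ^+ r = mu (F j).
      rewrite muF// (natrX _ 2 k0) -(mu_cell (ltn_ord j)).
      have -> : dyset k0 (pred1 (j : nat)) = dyset r (fun u => u %% L == j)%N.
        by apply/seteqP; split=> x [Ix] /=; rewrite /(dyset _ _) /= (address_mod _ k0r).
      by rewrite mu_dyset.
    pose G u : bool := if insub u is Some v then g0 v == j else false.
    have GE (v : 'I_(2 ^ r)) : G v = (g0 v == j).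
      by rewrite /G insubT//= => h; congr (g0 _ == j); exact: val_inj.
    have e2 : #|[pred u | g0 u == j]|%:R / 2 ^+ r = mu (dyset r G).
      by rewrite mu_dyset; congr (_%:R / _); apply: eq_card => u; rewrite !inE GE.
    have h3 : mu (F j) <= mu (dyset r G) + mu bad.
      apply: muU_le => // y [Fy Iy].
      have [bady|nby] := pselect (bad y); [by right|left].
      split=> //; have yr := address_lt r y.
      by rewrite -[address r y]/(val (Ordinal yr)) GE (lab y yr j).
    case: (leqP #|[pred u | d u == j]| #|[pred u | g0 u == j]|) => h.
      by rewrite (eqP (h : _ == _)) mul0r mu_ge0.
    by rewrite natrB 1?ltnW// mulrBl e1 e2; lra.
  apply: (@le_trans _ _ ((\sum_(j < L) (#|[pred u | d u == j]| - #|[pred u | g0 u == j]|) + 2 * L)%N%:R / 2 ^+ r)).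
    by rewrite ler_pM2r ?invr_gt0// ler_nat.
  rewrite natrD mulrDl natr_sum mulr_suml natrM.
  have h4 : \sum_(j < L) (#|[pred u | d u == j]| - #|[pred u | g0 u == j]|)%:R / 2 ^+ r <= e / 8.
    apply: (@le_trans _ _ (\sum_(j < L) mu bad)); first exact: ler_sum.
    by rewrite sumr_const card_ord -(mulr_natr (mu bad) L) -ler_pdivlMr.
  by lra.
(* Off [bad] and the images of [W] and [N], the preimages of [y] under [sigma] and [tau] lie in the
   same coarse cell; [bad] contributes at most [e / 8] and [W] at most [e / 4]. *)
have key Q : mu (symdiff (sigma @` dyset k0 Q) (tau @` dyset k0 Q)) <= 3 * e / 8.
  have sD (x : R) : dyset k0 Q x -> I01 x by case.
  have [ms sI _] := inM_image sM (measurable_dyset k0 Q) sD.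
  have [mt tI _] := inM_image tM (measurable_dyset k0 Q) sD.
  have [msW _ esW] := inM_image sM (measurable_dyset r fl) (fun x => @proj1 _ _).
  have NI : N `<=` I01 by move=> x [].
  have [msN _ esN] := inM_image sM mN NI.
  apply: (@le_trans _ _ (mu bad + mu (sigma @` W `|` sigma @` N))).
    apply: muU_le => //; [exact: measurable_symdiff|exact: measurableU|].
    move=> y [sy Iy]; have [bady|nby] := pselect (bad y); [by left|right].
    have [x Ix xy] := inM_surj sM Iy; have [z Iz zy] := inM_surj tM Iy.
    have [Nx|nNx] := pselect (N x); first by right; exists x.
    have [Wx|nWx] := pselect (W x); first by left; exists x.
    exfalso.
    have yr := address_lt r y; have xr := address_lt r x.
    have zl : (address k0 z < L)%N := address_lt k0 z.
    have g0y : g0 (Ordinal yr) = Ordinal zl.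
      by apply: lab => //; exists z => //; split=> //; exact/eqP.
    have yE : Ordinal yr = c (Ordinal xr).
      apply: val_inj; rewrite /= -xy address_conj_odo//.
      by rewrite -[address r x]/(val (Ordinal xr)) -fc fK.
    have xz : address k0 x = address k0 z.
      have : g0 (c (Ordinal xr)) = d (Ordinal xr).
        apply/eqP/negPn/negP => h; apply: nWx; split=> //.
        by rewrite -[address r x]/(val (Ordinal xr)) flE.
      by rewrite -yE g0y => /(congr1 val) /= ->; rewrite (address_mod _ k0r).
    have sQ : (sigma @` dyset k0 Q) y <-> Q (address k0 x).
      split=> [[x' [Ix' Qx'] x'y]|Qx]; last by exists x.
      by have <- : x' = x by apply: (inM_inj sM) => //; rewrite x'y.
    have tQ : (tau @` dyset k0 Q) y <-> Q (address k0 z).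
      split=> [[x' [Ix' Qx'] x'y]|Qx]; last by exists z.
      by have <- : x' = z by apply: (inM_inj tM) => //; rewrite x'y.
    rewrite xz in sQ.
    by case: sy => -[h1 h2]; apply: h2; [apply/tQ/sQ|apply/sQ/tQ].
  have h5 : mu (sigma @` W `|` sigma @` N) <= mu (sigma @` W) + mu (sigma @` N).
    by apply: muU_le => //; exact: measurableU.
  have h6 : e / 8 / L%:R <= e / 8.
    by rewrite ler_pdivrMr//; apply: ler_peMr; [exact: ltW|rewrite ler1n].
  by rewrite esW esN N0 in h5; lra.
move=> i ik; have [mA AI] := mAs i ik; have [Q hQi] := hQ i ik.
set D := dyset k0 Q in hQi.
have mD : measurable D by exact: measurable_dyset.
have DI : D `<=` I01 by move=> x [].
have mAD := measurable_symdiff mA mD.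
have ADI : symdiff (As i) D `<=` I01 by move=> x [[/AI]|[/DI]].
have [m1 _ e1] := inM_image sM mAD ADI; have [m2 _ e2] := inM_image tM mAD ADI.
have [m3 _ _] := inM_image sM mA AI; have [m4 _ _] := inM_image tM mA AI.
have [m5 _ _] := inM_image sM mD DI; have [m6 _ _] := inM_image tM mD DI.
(* Replacing [As i] by [D] costs less than [e / 8] under each of the two maps; with [key] the total
   stays below [e]. *)
have h7 : mu (symdiff (sigma @` As i) (tau @` As i)) <=
    mu (sigma @` symdiff (As i) D `|` tau @` symdiff (As i) D) +
    mu (symdiff (sigma @` D) (tau @` D)).
  apply: muU_le; [exact: measurable_symdiff|exact: measurableU|exact: measurable_symdiff|].
  move=> y [[[[x Ax xy] nty]|[[x Ax xy] nsy]] Iy].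
  - have [Dx|nDx] := pselect (D x); last by left; left; exists x => //; left.
    have [[z Dz zy]|nD] := pselect ((tau @` D) y); last by right; left; split=> //; exists x.
    left; right; exists z => //; right; split=> // Az; apply: nty; by exists z.
  - have [Dx|nDx] := pselect (D x); last by left; right; exists x => //; left.
    have [[z Dz zy]|nD] := pselect ((sigma @` D) y); last by right; right; split=> //; exists x.
    left; left; exists z => //; right; split=> // Az; apply: nsy; by exists z.
have h8 : mu (sigma @` symdiff (As i) D `|` tau @` symdiff (As i) D) <=
    mu (sigma @` symdiff (As i) D) + mu (tau @` symdiff (As i) D).
  by apply: muU_le => //; exact: measurableU.
have h9 := key Q; rewrite -/D in h9.
by rewrite e1 e2 in h8; lra.
Qed.

End WeakApproximation.

(** * Density *)

Section Density.
Context {R : realType}.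
Local Notation I01 := (@I01 R).
Local Notation m := (@lebesgue_measure R).
Local Notation dyset := (@dyset R).
Local Notation address := (@address R).
Hint Resolve measurable_I01 measurable_dyset : core.

Lemma measurable_cball (y r : R) : measurable (cball y r).
Proof.
have -> : cball y r = I01 `&` \bigcup_(k : int) `[y + k%:~R - r, y + k%:~R + r]%classic.
  apply/seteqP; split=> x [Ix]; first move=> [k].
    move=> h; split=> //; exists k => //=; rewrite in_itv /=.
    by move: h; rewrite ler_norml => /andP[h1 h2]; apply/andP; split; lra.
  move=> [k _ /=]; rewrite in_itv /= => /andP[h1 h2].
  by split=> //; exists k; rewrite ler_norml; apply/andP; split; lra.
apply: measurableI => //; apply: countable_bigcupT_measurable => //.
Qed.

Lemma m_eq1 (A : set R) : measurable A -> A `<=` I01 -> 1 <= mu A -> m A = 1%E.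
Proof.
move=> mA AI h; rewrite m_muS//; congr EFin; apply/eqP.
by rewrite eq_le h mu_le1.
Qed.

Definition hit_union (eps : nat -> R) (tau : R -> R) (N : nat) (y : R) : set R :=
  \bigcup_(n in [set n | (N <= n)%N]) ((iter n tau) @^-1` (cball y (eps n)) `&` I01).

Lemma measurable_hit_union eps tau N y : inM tau -> measurable (hit_union eps tau N y).
Proof.
move=> tM; apply: bigcup_measurable => n _.
by have [] := inM_preimage (inM_iter n tM) (measurable_cball y (eps n)).
Qed.

Lemma hit_union_I01 eps tau N y : hit_union eps tau N y `<=` I01.
Proof. by move=> x [n _ []]. Qed.

Variable eps : nat -> R.
Hypothesis eps_pos : forall n, (1 <= n)%N -> 0 < eps n.
Hypothesis eps_decr : forall n p, (1 <= n)%N -> (n <= p)%N -> eps p <= eps n.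
Hypothesis eps_div : (fun n => \sum_(1 <= k < n) eps k) @ \oo --> +oo.

Lemma eps_tail_div N M : (1 <= N)%N -> exists d, M < \sum_(i < d) eps (N + i)%N.
Proof.
move=> N1; move/cvgryPgt : eps_div => /(_ (M + \sum_(1 <= k < N) eps k)) [n0 _ h].
have := h (maxn n0 N) (leq_maxl _ _) => /=.
have Nn : (N <= maxn n0 N)%N by exact: leq_maxr.
rewrite [X in _ < X](@big_cat_nat _ _ _ _ _ _ _ _ N1 Nn) /= [X in _ < X]addrC ltrD2r => h1.
exists (maxn n0 N - N)%N; move: h1.
rewrite -{1}(add0n N) big_addn big_mkord.
by under eq_bigr do rewrite addnC.
Qed.

(** [k n] is the least admissible rank, so its cell size is at least a fixed multiple of [eps n] and
    divergence is inherited. *)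
Lemma dyadic_minorant r : exists k : nat -> nat,
  [/\ forall i j, (i <= j)%N -> (k i <= k j)%N,
      forall n, (r <= k n)%N,
      forall n, (1 <= n)%N -> (2 ^+ k n)^-1 <= eps n &
      forall (N : nat) (M : R), (1 <= N)%N ->
        exists d, M < \sum_(i < d) (2 ^+ k (N + i)%N)^-1].
Proof.
(* [maxn n 1], as [eps] is known to be positive and decreasing from index 1 on. *)
pose good n k := (r <= k)%N && ((2 ^+ k)^-1 <= eps (maxn n 1)).
have ex n : exists k, good n k.
  have [k hk] := exp2_small (eps_pos (leq_maxr n 1)).
  exists (maxn r k); rewrite /good leq_maxl /=; apply: le_trans (ltW hk).
  by apply: exp2V_le; rewrite leq_maxr.
pose k n := ex_minn (ex n).
have kP n : good n (k n) by rewrite /k; case: ex_minnP.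
have kmin n j : good n j -> (k n <= j)%N by rewrite /k; case: ex_minnP => ? _; exact.
have e1 := eps_pos (leqnn 1).
(* The first term serves [k n > r], where minimality loses at most a factor 2; the second serves
   [k n = r], using [eps n <= eps 1]. *)
pose c : R := Num.min 2^-1 ((2 ^+ r)^-1 / eps 1).
have c0 : 0 < c by rewrite lt_min invr_gt0 ltr0n /= divr_gt0// exp2V_gt0.
have kc n : (1 <= n)%N -> c * eps n <= (2 ^+ k n)^-1.
  move=> n1; have en := eps_pos n1; have /andP[rk ek] := kP n.
  move: rk; rewrite leq_eqVlt => /orP[/eqP <-|].
    apply: (@le_trans _ _ ((2 ^+ r)^-1 / eps 1 * eps n)).
      by apply: ler_wpM2r; [exact: ltW|rewrite ge_min lexx orbT].
    rewrite -mulrA ler_piMr ?(ltW (exp2V_gt0 _))// mulrC ler_pdivrMr// mul1r.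
    exact: eps_decr.
  case ek' : (k n) => [//|j] rj.
  have : ~~ good n j by apply/negP => /kmin; rewrite ek' ltnn.
  rewrite /good -ltnS rj /= -ltNge (maxn_idPl n1) => h.
  apply: (@le_trans _ _ (2^-1 * eps n)).
    by apply: ler_wpM2r; [exact: ltW|rewrite ge_min lexx].
  by rewrite exprS invfM ler_pM2l ?invr_gt0// ltW.
exists k; split.
- move=> i j ij; apply: kmin; have /andP[h1 h2] := kP j.
  rewrite /good h1 (le_trans h2)//; apply: eps_decr; first exact: leq_maxr.
  by rewrite geq_max !leq_max ij leqnn orbT.
- by move=> n; have /andP[] := kP n.
- by move=> n n1; have /andP[_] := kP n; rewrite (maxn_idPl n1).
- move=> N M N1; have [d hd] := eps_tail_div (M / c) N1.
  exists d; apply: (@lt_le_trans _ _ (c * \sum_(i < d) eps (N + i)%N)).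
    by rewrite mulrC -ltr_pdivrMr.
  by rewrite mulr_sumr; apply: ler_sum => i _; apply: kc; rewrite ltn_addr.
Qed.

(** Relabelling preserves the cells of rank [k n >= r], so hits of the odometer near the relabelled
    centre become hits of the conjugate near [y]. *)
Lemma conj_odo_shrinking_target r (f g : nat -> nat) :
  (forall i, (i < 2 ^ r)%N -> (f i < 2 ^ r)%N) ->
  (forall i, (i < 2 ^ r)%N -> (g i < 2 ^ r)%N) ->
  (forall i, (i < 2 ^ r)%N -> g (f i) = i) ->
  (forall i, (i < 2 ^ r)%N -> f (g i) = i) ->
  shrinking_target_full eps (conj_odo r f g).
Proof.
(* The only exceptional centre is 1, which lies outside the fundamental domain. *)
move=> f_lt g_lt fK gK; exists [set 1].
split; first exact: measurable_set1.
split; first exact: lebesgue_measure_set1.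
move=> y /=; rewrite in_itv /= => /andP[y0 y1] ny1 N N1.
have Iy : I01 y by rewrite I01P y0 lt_neqAle y1 andbT; apply/eqP.
have sM : inM (@conj_odo R r f g) := conj_odo_inM f_lt g_lt fK gK.
have fM : inM (@relabel R r f) := relabel_inM f_lt g_lt fK gK.
have [k [kmono rk keps kdiv]] := dyadic_minorant r.
have mV := measurable_hit_union eps N y sM.
rewrite -/(hit_union eps (conj_odo r f g) N y).
apply: m_eq1 => //; first exact: hit_union_I01.
pose yf := relabel r f y.
have Iyf : I01 yf by exact: relabel_I01.
have := mu_hit_io yf kmono (fun M => kdiv N M N1).
set W := \bigcup_(n in _) _ => W1.
have mW : measurable W by apply: bigcup_measurable => n _; exact: measurable_dyset.
have [mpW epW] := inM_preimage fM mW.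
have [mN N0] := @conj_orbit0P R r f g f_lt g_lt fK gK.
rewrite -W1 -epW -[leRHS]addr0 -N0; apply: muU_le => // x [[[n /= Nn [_ hx]] Ix] _].
have [Nx|nNx] := pselect (conj_orbit0 r f x); [by right|left].
exists n => //; split=> //=.
have Ixf : I01 (relabel r f x) by exact: relabel_I01.
have nOx : ~ orbit0 (relabel r f x) by move=> h; apply: nNx.
have [Ion _ aon] := iter_odo n Ixf nOx.
rewrite iter_conj_odo//; split; first exact: relabel_I01.
(* Points of a common cell are close without wrapping around the circle, hence the integer 0. *)
exists 0; rewrite subr0; apply: le_trans (keps n (leq_trans N1 Nn)).
rewrite -{1}(relabelK f_lt fK Iy); apply/ltW/address_dist; try exact: relabel_I01.
apply: (address_relabel_eq g_lt) => //.
by rewrite aon (eqP hx) modn_small ?address_lt.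
Qed.

Lemma Rset_dense : weak_dense (Rset eps).
Proof.
move=> U [UM Uo] [tau Ut]; have [k [As [e [mAs [e0 hU]]]]] := Uo tau Ut.
have tM := UM tau Ut.
have [r [f [g [f_lt g_lt fK gK h]]]] := weak_approximation tM mAs e0.
have sM : inM (@conj_odo R r f g) := conj_odo_inM f_lt g_lt fK gK.
exists (conj_odo r f g); split.
  apply: hU => // i ik; have [mA AI] := mAs i ik.
  have [m1 I1 _] := inM_image sM mA AI; have [m2 I2 _] := inM_image tM mA AI.
  rewrite m_muS ?lte_fin; first exact: h.
    exact: measurable_symdiff.
  by move=> x [[/I1]|[/I2]].
split=> //; split; first exact: conj_odo_ergodic.
exact: conj_odo_shrinking_target.
Qed.

End Density.

(** * Weak neighbourhoods *)

Section WeakNeighborhoods.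
Context {R : realType}.
Local Notation I01 := (@I01 R).
Local Notation m := (@lebesgue_measure R).
Hint Resolve measurable_I01 : core.

(** The neighbourhood filter of [tau] in the weak topology, so that openness can be derived by
    finite intersections and inclusions. *)
Definition wnear (tau : R -> R) (P : (R -> R) -> Prop) : Prop :=
  exists (k : nat) (As : nat -> set R) (e : R),
    [/\ forall i, (i < k)%N -> measurable (As i) /\ As i `<=` I01, 0 < e &
     forall sigma, inM sigma ->
       (forall i, (i < k)%N -> mu (symdiff (sigma @` As i) (tau @` As i)) < e) ->
       P sigma].

Lemma wnear_open (U : set (R -> R)) : U `<=` inM (R := R) ->
  (forall tau, U tau -> wnear tau U) -> weak_open U.
Proof.
move=> UM Un; split=> // tau Ut; have [k [As [e [mAs e0 h]]]] := Un tau Ut.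
exists k, As, e; split=> //; split=> // sigma sM hs; apply: h => // i ik.
have [mA AI] := mAs i ik.
have [m1 I1 _] := inM_image sM mA AI; have [m2 I2 _] := inM_image (UM _ Ut) mA AI.
rewrite -lte_fin -m_muS; first exact: hs.
  exact: measurable_symdiff.
by move=> x [[/I1]|[/I2]].
Qed.

Lemma wnearT tau (P : (R -> R) -> Prop) : (forall sigma, inM sigma -> P sigma) ->
  wnear tau P.
Proof. by move=> h; exists 0%N, (fun=> set0), 1; split=> // s sM _; exact: h. Qed.

Lemma wnearS tau (P Q : (R -> R) -> Prop) :
  (forall sigma, inM sigma -> P sigma -> Q sigma) -> wnear tau P -> wnear tau Q.
Proof.
move=> PQ [k [As [e [mAs e0 h]]]]; exists k, As, e; split=> // sigma sM hs.
by apply: PQ => //; exact: h.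
Qed.

Lemma wnearI tau (P Q : (R -> R) -> Prop) : wnear tau P -> wnear tau Q ->
  wnear tau (fun sigma => P sigma /\ Q sigma).
Proof.
move=> [k [As [e [mAs e0 h]]]] [k' [As' [e' [mAs' e0' h']]]].
exists (k + k')%N, (fun i => if (i < k)%N then As i else As' (i - k)%N), (Num.min e e').
split=> [i ik||sigma sM hs].
- case: (ltnP i k) => ik'; [exact: mAs ik'|apply: mAs'].
  by rewrite ltn_subLR.
- by rewrite lt_min e0 e0'.
split.
- apply: h => // i ik; have := hs i; rewrite ik lt_min ltn_addr// => /(_ isT)/andP[].
  by [].
- apply: h' => // i ik; have := hs (k + i)%N.
  have h0 : (k + i < k)%N = false by lia.
  by rewrite h0 addKn lt_min ltn_add2l ik => /(_ isT)/andP[].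
Qed.

Lemma wnear_fin tau n (P : nat -> (R -> R) -> Prop) :
  (forall i, (i < n)%N -> wnear tau (P i)) ->
  wnear tau (fun sigma => forall i, (i < n)%N -> P i sigma).
Proof.
elim: n => [|n IH] h; first exact: wnearT.
have h1 : wnear tau (fun sigma => forall i, (i < n)%N -> P i sigma).
  by apply: IH => i ni; apply: h; rewrite ltnS ltnW.
apply: wnearS (wnearI h1 (h n (ltnSn n))) => sigma _ [h2 h3] i.
by rewrite ltnS leq_eqVlt => /predU1P[->//|]; exact: h2.
Qed.

Lemma wnear_image tau (A : set R) (e : R) : measurable A -> A `<=` I01 -> 0 < e ->
  wnear tau (fun sigma => mu (symdiff (sigma @` A) (tau @` A)) < e).
Proof.
by move=> mA AI e0; exists 1%N, (fun=> A), e; split=> // sigma sM /(_ 0%N isT).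
Qed.

Lemma symdiffC (A B : set R) : symdiff A B = symdiff B A.
Proof. by rewrite /symdiff setUC. Qed.

Lemma symdiff_trans (A B C : set R) : symdiff A C `<=` symdiff A B `|` symdiff B C.
Proof.
move=> x [[Ax nCx]|[Cx nAx]]; have [Bx|nBx] := pselect (B x).
- by right; left.
- by left; left.
- by left; right.
- by right; right.
Qed.

Lemma mu_image_symdiff tau (A B : set R) : inM tau -> measurable A -> measurable B ->
  A `<=` I01 -> B `<=` I01 -> mu (symdiff (tau @` A) (tau @` B)) = mu (symdiff A B).
Proof.
move=> tM mA mB AI BI.
have sI : symdiff A B `<=` I01 by move=> x [[/AI]|[/BI]].
have [_ _ <-] := inM_image tM (measurable_symdiff mA mB) sI.
have notin (X Y : set R) x : X `<=` I01 -> Y `<=` I01 -> X x -> ~ Y x ->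
    ~ (tau @` Y) (tau x).
  by move=> XI YI Xx nY [z Yz /(inM_inj tM (YI z Yz) (XI x Xx)) e]; rewrite e in Yz.
congr mu; apply/seteqP; split=> y.
  move=> [[[x Ax <-] nB]|[[x Bx <-] nA]]; exists x => //; [left|right]; split=> // h.
move=> [x [[Ax nB]|[Bx nA]] <-]; [left|right]; (split; first by exists x).
  exact: notin Ax nB.
exact: notin Bx nA.
Qed.

Lemma iterS_image (tau : R -> R) n (A : set R) :
  iter n.+1 tau @` A = tau @` (iter n tau @` A).
Proof. by rewrite -image_comp. Qed.

Lemma wnear_iter_image tau n (A : set R) (e : R) : inM tau -> measurable A ->
  A `<=` I01 -> 0 < e ->
  wnear tau (fun sigma => mu (symdiff (iter n sigma @` A) (iter n tau @` A)) < e).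
Proof.
move=> tM mA AI; elim: n e => [|n IH] e e0.
  apply: wnearT => sigma _; rewrite (_ : symdiff _ _ = set0) ?mu_set0//.
  by rewrite /symdiff setDv setU0.
have [mT TI _] := inM_image (inM_iter n tM) mA AI.
have e20 : 0 < e / 2 by rewrite divr_gt0.
apply: wnearS (wnearI (IH _ e20) (wnear_image tau mT TI e20)) => sigma sM [h1 h2].
have [mS SI _] := inM_image (inM_iter n sM) mA AI.
rewrite !iterS_image.
have [m1 _ _] := inM_image sM mS SI; have [m2 _ _] := inM_image sM mT TI.
have [m3 _ _] := inM_image tM mT TI.
apply: (@le_lt_trans _ _ (mu (symdiff (sigma @` (iter n sigma @` A)) (sigma @` (iter n tau @` A)))
   + mu (symdiff (sigma @` (iter n tau @` A)) (tau @` (iter n tau @` A))))).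
  apply: muU_le; try exact: measurable_symdiff.
  by move=> x [h _]; exact: symdiff_trans.
rewrite (mu_image_symdiff sM mS mT SI TI).
by lra.
Qed.

(** Apply the image version to the preimage of [B] under [iter n tau]: both sides become images
    under [iter n sigma], which is measure preserving and cancels. *)
Lemma wnear_iter_preimage tau n (B : set R) (e : R) : inM tau -> measurable B -> 0 < e ->
  wnear tau (fun sigma => mu (symdiff (iter n sigma @^-1` B `&` I01)
                                      (iter n tau @^-1` B `&` I01)) < e).
Proof.
move=> tM mB e0; have tnM := inM_iter n tM.
have [mT _] := inM_preimage tnM mB.
have TI : iter n tau @^-1` B `&` I01 `<=` I01 by move=> x [].
have img (s : R -> R) : inM s -> s @` (s @^-1` B `&` I01) = B `&` I01.
  move=> sM; apply/seteqP; split=> [_ [x [Bx Ix] <-]|y [By Iy]].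
    by split=> //; exact: inM_maps Ix.
  by have [x Ix xy] := inM_surj sM Iy; exists x => //; split=> //; rewrite /preimage /= xy.
apply: wnearS (wnear_iter_image n tM mT TI e0) => sigma sM.
have snM := inM_iter n sM; have [mS _] := inM_preimage snM mB.
have SI : iter n sigma @^-1` B `&` I01 `<=` I01 by move=> x [].
by rewrite img// -(img _ snM) mu_image_symdiff// symdiffC.
Qed.

(** The errors of the [K] pieces add up; the denominator [K.+1] admits [K = 0] and keeps the total
    strictly below [e]. *)
Lemma mu_bigcup_close (X Y : nat -> set R) K (P : pred nat) (e : R) : 0 < e ->
  (forall n, measurable (X n)) -> (forall n, measurable (Y n)) ->
  (forall n, (n < K)%N -> mu (symdiff (Y n) (X n)) < e / K.+1%:R) ->
  mu (\bigcup_(n in [set n | (n < K)%N && P n]) X n `\`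
      \bigcup_(n in [set n | (n < K)%N && P n]) Y n) < e.
Proof.
move=> e0 mX mY h.
apply: (@le_lt_trans _ _ (\sum_(n < K) mu (symdiff (Y n) (X n)))).
  apply: (@mu_sum_le _ K (fun n => symdiff (Y n) (X n))).
  - by apply: measurableD; apply: bigcup_measurable.
  - by move=> n _; exact: measurable_symdiff.
  - move=> x [[n /= nP Xx] nY] _; exists n; first by case/andP: nP.
    by right; split=> // Yx; apply: nY; exists n.
apply: (@le_lt_trans _ _ (\sum_(n < K) e / K.+1%:R)).
  by apply: ler_sum => n _; exact/ltW/h.
rewrite sumr_const card_ord -(mulr_natr (e / _) K) mulrAC ltr_pdivrMr ?ltr0n//.
by rewrite ltr_pM2l// ltr_nat.
Qed.

End WeakNeighborhoods.

(** * Ergodicity is a G_delta condition *)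

Section ErgodicGdelta.
Context {R : realType}.
Local Notation I01 := (@I01 R).
Local Notation m := (@lebesgue_measure R).
Local Notation dyset := (@dyset R).
Local Notation address := (@address R).
Hint Resolve measurable_I01 measurable_dyset : core.

(** The set of points visiting [B] infinitely often is exactly invariant, as [ergodic] demands, and
    has measure at least [mu B] because every tail union contains a preimage of [B]. *)
Lemma ergodic_sweep (tau : R -> R) (B : set R) : inM tau -> ergodic tau ->
  measurable B -> 0 < mu B ->
  mu (\bigcup_n (iter n tau @^-1` B `&` I01)) = 1.
Proof.
move=> tM erg mB B0.
have mtB n : measurable (iter n tau @^-1` B `&` I01).
  by have [] := inM_preimage (inM_iter n tM) mB.
pose V j := \bigcup_(n in [set n | (j <= n)%N]) (iter n tau @^-1` B `&` I01).
have VI j : V j `<=` I01 by move=> x [n _ []].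
have mV j : measurable (V j) by exact: bigcup_measurable.
have muV j : mu B <= mu (V j).
  have [h1 <-] := inM_preimage (inM_iter j tM) mB.
  by apply: mu_mono => // x [h _]; exists j => //=.
pose W := \bigcap_j V j.
have mW : measurable W by exact: bigcapT_measurable.
have WI : W `<=` I01 by move=> x /(_ 0%N Logic.I); exact: VI.
have inv : tau @^-1` W `&` I01 = W.
  apply/seteqP; split=> [x [Wx Ix] j _|x Wx].
    have [n /= jn [Bx _]] := Wx j Logic.I.
    exists n.+1; [exact: leqW|split=> //].
    by change (B (iter n.+1 tau x)); rewrite iterSr.
  have Ix := WI x Wx; split=> // j _.
  have [[//|n] /= jn [Bx _]] := Wx j.+1 Logic.I.
  exists n => //; split; last exact: inM_maps Ix.
  by change (B (iter n tau (tau x))); rewrite -iterSr.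
have W0 : mu B <= mu W.
  rewrite leNgt; apply/negP => h.
  have [|j] := @mu_down _ V (mu B) mV _ h; last by rewrite ltNge muV.
  by move=> n x [i /= ni Bx]; exists i => //=; exact: ltnW.
have W1 : mu W = 1.
  have [] := erg W mW WI inv; rewrite m_muS// => -[e] //.
  by move: W0; rewrite e leNgt B0.
apply/eqP; rewrite eq_le mu_le1/=; last exact: bigcupT_measurable.
rewrite -W1; apply: mu_mono => //; first exact: bigcupT_measurable.
by move=> x [/(_ 0%N Logic.I) [n _ h] _]; exists n.
Qed.

(** The parts of [A] and [B] still unmatched before time [n]; at time [k], each remaining point of
    [A] sent by the [k]-th iterate into the rest of [B] is matched with its image. *)
Fixpoint greedy (tau : R -> R) (A B : set R) (n : nat) : set R * set R :=
  if n is k.+1 then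
    let: (a, b) := greedy tau A B k in
    let M := a `&` (iter k tau @^-1` b `&` I01) in
    (a `\` M, b `\` (iter k tau @` M))
  else (A, B).

Definition matched (tau : R -> R) (A B : set R) (n : nat) : set R :=
  (greedy tau A B n).1 `&` (iter n tau @^-1` (greedy tau A B n).2 `&` I01).

Lemma greedyS tau A B n : greedy tau A B n.+1 =
  ((greedy tau A B n).1 `\` matched tau A B n,
   (greedy tau A B n).2 `\` (iter n tau @` matched tau A B n)).
Proof. by rewrite /matched /=; case: (greedy tau A B n). Qed.

Section Greedy.
Variables (tau : R -> R) (A B : set R).
Hypotheses (tM : inM tau) (mA : measurable A) (mB : measurable B).
Hypotheses (AI : A `<=` I01) (BI : B `<=` I01).
Local Notation a n := (greedy tau A B n).1.
Local Notation b n := (greedy tau A B n).2.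
Local Notation M n := (matched tau A B n).

Lemma measurable_greedy n : measurable (a n) /\ measurable (b n) /\ measurable (M n).
Proof.
have H k : measurable (a k) -> measurable (b k) -> measurable (M k).
  move=> ma mb; have [h _] := inM_preimage (inM_iter k tM) mb.
  exact: measurableI.
elim: n => [|n [ma [mb mM]]]; first by split=> //; split=> //; exact: H.
have MI : M n `<=` I01 by move=> x [_ []].
have [mi _ _] := inM_image (inM_iter n tM) mM MI.
have m1 : measurable (a n.+1) by rewrite greedyS; exact: measurableD.
have m2 : measurable (b n.+1) by rewrite greedyS; exact: measurableD.
by split=> //; split=> //; exact: H.
Qed.

Lemma greedy_decr n : a n.+1 `<=` a n /\ b n.+1 `<=` b n.
Proof. by rewrite greedyS; split=> x []. Qed.

Lemma greedy_sub n : a n `<=` A /\ b n `<=` B.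
Proof.
elim: n => [|n [h1 h2]]; first by split.
have [h3 h4] := greedy_decr n.
by split=> x; [move/h3/h1|move/h4/h2].
Qed.

Lemma mu_greedy n : mu (a n) - mu (b n) = mu A - mu B.
Proof.
elim: n => // n IH; have [ma [mb mM]] := measurable_greedy n.
have MI : M n `<=` I01 by move=> x [_ []].
have [mi _ ei] := inM_image (inM_iter n tM) mM MI.
have e1 := muDI ma mM; have e2 := muDI mb mi.
rewrite setIidr in e1; last by move=> x [].
rewrite setIidr in e2; last by move=> _ [x [_ [bx _]] <-].
by rewrite greedyS /=; lra.
Qed.

Lemma matched_disjoint i j : (i < j)%N -> M i `&` M j = set0.
Proof.
move=> ij; apply/seteqP; split=> // x [Mi [aj _]].
have : a i.+1 x.
  elim: j ij aj => // j IH; rewrite ltnS leq_eqVlt => /predU1P[->//|ij].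
  by move/(greedy_decr j).1/(IH ij).
by rewrite greedyS => -[].
Qed.

Lemma greedy_uncovered n x : B x ->
  (forall i, (i < n)%N -> ~ (iter i tau @` M i) x) -> b n x.
Proof.
move=> Bx; elim: n => // n IH h; rewrite greedyS; split; last exact: h.
by apply: IH => i ni; apply: h; rewrite ltnS ltnW.
Qed.

(** Both sides lose equal measure, so the limit remainder of [A] is at least as large as that of
    [B]. Were the latter of positive measure, almost every point of the former would enter it at
    some time and would have been matched then. *)
Lemma greedy_exhausts (e : R) : ergodic tau -> mu B <= mu A -> 0 < e ->
  exists n, mu (b n) < e.
Proof.
move=> erg BA e0.
pose ainf := \bigcap_n a n; pose binf := \bigcap_n b n.
have ma n : measurable (a n) by case: (measurable_greedy n).
have mb n : measurable (b n) by case: (measurable_greedy n) => _ [].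
have mai : measurable ainf by exact: bigcapT_measurable.
have mbi : measurable binf by exact: bigcapT_measurable.
have ab : mu binf <= mu ainf.
  rewrite leNgt; apply/negP => h.
  have [|n] := @mu_down _ (fun n => a n) (mu binf) ma _ h.
    by move=> n; case: (greedy_decr n).
  apply/negP; rewrite -leNgt.
  have : mu binf <= mu (b n) by apply: mu_mono => // x [h' _]; exact: h'.
  by have := mu_greedy n; lra.
suff b0 : mu binf = 0.
  apply: (@mu_down _ (fun n => b n)) => //; last by rewrite b0.
  by move=> n; case: (greedy_decr n).
apply/eqP; rewrite eq_le mu_ge0 andbT leNgt; apply/negP => b0.
have := ergodic_sweep tM erg mbi b0; set W := \bigcup_n _ => W1.
have mW : measurable W.
  by apply: bigcupT_measurable => n; have [] := inM_preimage (inM_iter n tM) mbi.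
have : mu ainf + mu W <= 1.
  rewrite -muU//.
    by apply: mu_le1; exact: measurableU.
  apply/seteqP; split=> // x [[ax [n _ [/= bx Ix]]] _].
  have := ax n.+1 Logic.I; rewrite greedyS => -[_]; apply.
  by split; [exact: ax|split=> //; exact: bx].
by lra.
Qed.

End Greedy.

(* Together over all dyadic [dyset r P] these open conditions characterize
   ergodicity. *)
Definition transports (r : nat) (P : pred nat) (e : R) (tau : R -> R) : Prop :=
  2^-1 <= mu (dyset r P) ->
  exists (K : nat) (An : nat -> set R),
    [/\ forall n, measurable (An n) /\ An n `<=` dyset r P,
        forall i j, (i < j)%N -> An i `&` An j = set0 &
        mu ((I01 `\` dyset r P) `\`
            \bigcup_(n in [set n | (n < K)%N && predT n]) (iter n tau @` An n)) < e].

(** Greedy matching; measure at least 1/2 makes the complement no larger than the dyadic set. *)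
Lemma ergodic_transports r P e tau : inM tau -> ergodic tau -> 0 < e ->
  transports r P e tau.
Proof.
move=> tM erg e0 hA.
set A := dyset r P in hA *; pose B := I01 `\` A.
have mA : measurable A by exact: measurable_dyset.
have mB : measurable B by exact: measurableD measurable_I01 mA.
have AI : A `<=` I01 by move=> x [].
have BI : B `<=` I01 by move=> x [].
have BA : mu B <= mu A.
  have := muDI measurable_I01 mA; rewrite mu_I01 setIC muI_I01 -/B.
  by lra.
have [K hK] := greedy_exhausts tM mA mB erg BA e0.
have mM n := (measurable_greedy tM mA mB n).2.2.
exists K, (matched tau A B); split.
- move=> n; split; first exact: mM.
  by move=> x [ax _]; exact: (greedy_sub tau A B n).1 x ax.
- exact: matched_disjoint.
- apply: le_lt_trans hK; apply: mu_mono.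
  + apply: measurableD => //; apply: bigcup_measurable => n _.
    by have [] := inM_image (inM_iter n tM) (mM n) (fun x h => h.2.2).
  + by have [_ []] := measurable_greedy tM mA mB K.
  + move=> x [[Bx nU] _]; apply: greedy_uncovered => // i iK h.
    by apply: nU; exists i => //=; rewrite iK.
Qed.

Lemma mu_sum_disjoint (F : nat -> set R) n : (forall i, measurable (F i)) ->
  (forall i j, (i < j)%N -> F i `&` F j = set0) ->
  \sum_(i < n) mu (F i) = mu (\bigcup_(i in [set i | (i < n)%N]) F i).
Proof.
move=> mF dF; elim: n => [|n IH].
  rewrite big_ord0 -mu_set0; congr mu; apply/seteqP; split=> // x [i].
  by [].
rewrite big_ord_recr /= IH -muU//.
- congr mu; apply/seteqP; split=> x.
    by case=> [[i /= ni Fi]|Fn]; [exists i => //=; exact: ltnW|exists n => /=].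
  move=> [i /=]; rewrite ltnS leq_eqVlt => /predU1P[->|ni] Fi; [by right|left].
  by exists i.
- exact: bigcup_measurable.
- apply/seteqP; split=> // x [[[i /= ni Fi] Fn] _].
  by have /seteqP[/(_ x) h _] := dF i n ni; apply: h.
Qed.

(** A point outside [C] lies in [A] (cost [eta]), or is not covered by the pieces (cost [e]), or is
    the image of a piece point, which by invariance is outside [C] too; such points have total
    measure at most that of the part of [A] outside [C]. *)
Lemma transports_invariant r P e (eta : R) tau (C : set R) : inM tau ->
  transports r P e tau -> measurable C -> C `<=` I01 -> tau @^-1` C `&` I01 = C ->
  2^-1 <= mu (dyset r P) -> mu (symdiff C (dyset r P)) < eta ->
  mu (I01 `\` C) <= e + 2 * eta.
Proof.
move=> tM tr mC CI inv hA hC.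
have iterC n x : I01 x -> C (iter n tau x) <-> C x.
  elim: n x => // n IH x Ix; rewrite iterSr IH; last exact: inM_maps tM Ix.
  by split=> [h|]; [rewrite -inv|rewrite -{1}inv => -[]].
have [K [An [mAn dAn hK]]] := tr hA.
set A := dyset r P in hA hC mAn hK *.
have mA : measurable A by exact: measurable_dyset.
have AI : A `<=` I01 by move=> x [].
have AnI n : An n `<=` I01 by move=> x /((mAn n).2)/AI.
have mD n : measurable (An n `\` C) by apply: measurableD => //; case: (mAn n).
have DI n : An n `\` C `<=` I01 by move=> x [/AnI].
have mAC : measurable (A `\` C) by exact: measurableD.
have AC : mu (A `\` C) < eta.
  apply: le_lt_trans hC; apply: mu_mono => //; first exact: measurable_symdiff.
  by move=> x [h _]; right.
have mtA n : measurable (iter n tau @` An n).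
  by have [] := inM_image (inM_iter n tM) (mAn n).1 (@AnI n).
set U := \bigcup_(n in _) _ in hK.
have mU : measurable U by exact: bigcup_measurable.
have mtD n : measurable (iter n tau @` (An n `\` C)).
  by have [] := inM_image (inM_iter n tM) (mD n) (@DI n).
pose U' := \bigcup_(n in [set n | (n < K)%N]) (iter n tau @` (An n `\` C)).
have mU' : measurable U' by exact: bigcup_measurable.
have hU' : mu U' <= mu (A `\` C).
  apply: (@le_trans _ _ (\sum_(n < K) mu (An n `\` C))).
    apply: (@le_trans _ _ (\sum_(n < K) mu (iter n tau @` (An n `\` C)))).
      apply: (@mu_sum_le _ K (fun n => iter n tau @` (An n `\` C))) => //.
    apply: ler_sum => n _.
    by have [_ _ ->] := inM_image (inM_iter n tM) (mD n) (@DI n).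
  rewrite (@mu_sum_disjoint (fun n => An n `\` C))//; last first.
    move=> i j ij; apply/seteqP; split=> // x [[Ai _] [Aj _]].
    by have /seteqP[/(_ x) h _] := dAn i j ij; apply: h.
  apply: mu_mono => //; first exact: bigcup_measurable.
  by move=> x [[n _ [Ax nC]] _]; split=> //; exact: (mAn n).2.
have mIC : measurable (I01 `\` C) by exact: measurableD measurable_I01 mC.
have mR : measurable ((I01 `\` A) `\` U) by apply: measurableD => //; exact: measurableD measurable_I01 mA.
have h1 : mu (I01 `\` C) <= mu (A `\` C) + mu ((I01 `\` A) `\` U `|` U').
  apply: muU_le => //; first exact: measurableU.
  move=> x [[Ix nC] _]; have [Ax|nA] := pselect (A x); [by left|right].
  have [[n /= nK [z Az zx]]|nU] := pselect (U x); [right|by left].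
  exists n; first by case/andP: nK.
  exists z => //; split=> // Cz; apply: nC; rewrite -zx.
  by apply/iterC => //; exact: AnI Az.
have h2 : mu ((I01 `\` A) `\` U `|` U') <= mu ((I01 `\` A) `\` U) + mu U'.
  by apply: muU_le => //; exact: measurableU.
by lra.
Qed.

(** Either a dyadic approximation of an invariant set or its complement has measure at least 1/2, so
    [transports_invariant] applies to the set or to its complement. *)
Lemma transports_ergodic tau : inM tau ->
  (forall r (P : pred nat) q, transports r P q.+1%:R^-1 tau) -> ergodic tau.
Proof.
move=> tM tr C mC CI inv.
have muc : mu C + mu (I01 `\` C) = 1.
  by have := muDI measurable_I01 mC; rewrite mu_I01 setIC muI_I01.
have [c0|c0] := eqVneq (mu C) 0; first by left; rewrite m_muS// c0.
have [c1|c1] := eqVneq (mu (I01 `\` C)) 0.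
  by right; rewrite m_muS//; congr EFin; lra.
exfalso.
have p0 : 0 < mu C by rewrite lt_neqAle eq_sym c0 mu_ge0.
have p1 : 0 < mu (I01 `\` C) by rewrite lt_neqAle eq_sym c1 mu_ge0.
(* With the precision of [transports] also below [eta], the bound obtained is less than [3 * eta],
   hence the 4. *)
pose eta := Num.min (mu C) (mu (I01 `\` C)) / 4.
have eta0 : 0 < eta by rewrite divr_gt0// lt_min p0.
have eC : eta * 4 <= mu C by rewrite /eta divfK// ge_min lexx.
have eC' : eta * 4 <= mu (I01 `\` C) by rewrite /eta divfK// ge_min lexx orbT.
have [r /(_ r (leqnn _)) [P hP]] := dyset_approx mC eta0.
have [q _ /(_ q (leqnn _)) hq0] := near_infty_natSinv_lt (PosNum eta0).
have hq : q.+1%:R^-1 < eta := hq0.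
have [hA|hA] := leP 2^-1 (mu (dyset r P)).
  have := transports_invariant tM (tr r P q) mC CI inv hA hP.
  move=> h; have : mu (I01 `\` C) < eta + 2 * eta := le_lt_trans h (ltr_leD hq (lexx _)).
  by lra.
have mIC : measurable (I01 `\` C) by exact: measurableD measurable_I01 mC.
have ICI : I01 `\` C `<=` I01 by move=> x [].
have inv' : tau @^-1` (I01 `\` C) `&` I01 = I01 `\` C.
  have tC x : I01 x -> C (tau x) <-> C x.
    by move=> Ix; split=> [h|]; [rewrite -inv|rewrite -{1}inv => -[]].
  apply/seteqP; split=> x.
    by move=> [[_ nC] Ix]; split=> // /(tC x Ix).
  by move=> [Ix nC]; split=> //; split; [exact: inM_maps Ix|move/(tC x Ix)].
have dC : dyset r (predC P) = I01 `\` dyset r P.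
  apply/seteqP; split=> x [Ix Px]; split=> //=.
    by move=> [_ Px']; rewrite /= Px' in Px.
  by apply/negP => h; apply: Px.
have mP : measurable (dyset r P) by exact: measurable_dyset.
have hA' : 2^-1 <= mu (dyset r (predC P)).
  rewrite dC; have := muDI measurable_I01 mP; rewrite mu_I01 setIC muI_I01.
  by lra.
have hP' : mu (symdiff (I01 `\` C) (dyset r (predC P))) < eta.
  apply: le_lt_trans hP; rewrite dC; apply: mu_mono.
  - by apply: measurable_symdiff => //; exact: measurableD measurable_I01 mP.
  - exact: measurable_symdiff.
  - move=> x [[[[_ nC] nD]|[[_ nP] nD]] Ix].
      right; split=> //; apply: contrapT => h; exact: nD.
    left; split=> //; apply: contrapT => h; exact: nD.
have := transports_invariant tM (tr r (predC P) q) mIC ICI inv' hA' hP'.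
rewrite (_ : I01 `\` (I01 `\` C) = C); last by rewrite setDD setIidr.
move=> h; have : mu C < eta + 2 * eta := le_lt_trans h (ltr_leD hq (lexx _)).
by lra.
Qed.

(** The same pieces serve for nearby maps: only finitely many images move, and the strict inequality
    leaves room. *)
Lemma wnear_transports r P e tau : inM tau -> transports r P e tau ->
  wnear tau (transports r P e).
Proof.
move=> tM tr; have [hA|hA] := leP 2^-1 (mu (dyset r P)); last first.
  by apply: wnearT => sigma _ h; move: hA; rewrite ltNge h.
have [K [An [mAn dAn hK]]] := tr hA.
set A := dyset r P in hA hK mAn *.
have AI n : An n `<=` I01 by move=> x /((mAn n).2) [].
set U := \bigcup_(n in _) _ in hK.
set B := I01 `\` A in hK.
have mA : measurable A by exact: measurable_dyset.
have mB : measurable B by exact: measurableD measurable_I01 mA.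
have d0 : 0 < e - mu (B `\` U) by rewrite subr_gt0.
have h0 : 0 < (e - mu (B `\` U)) / K.+1%:R by rewrite divr_gt0// ltr0n.
apply: wnearS (wnear_fin (n := K) (P := fun n sigma =>
   mu (symdiff (iter n sigma @` An n) (iter n tau @` An n)) < (e - mu (B `\` U)) / K.+1%:R) _);
  last by move=> n _; apply: wnear_iter_image => //; case: (mAn n).
move=> sigma sM hs _; exists K, An; split=> //.
have mt n : measurable (iter n tau @` An n).
  by have [] := inM_image (inM_iter n tM) (mAn n).1 (@AI n).
have ms n : measurable (iter n sigma @` An n).
  by have [] := inM_image (inM_iter n sM) (mAn n).1 (@AI n).
have := @mu_bigcup_close _ _ _ K predT _ d0 mt ms hs; rewrite -/U.
rewrite -/A -/B; set V := \bigcup_(n in _) _ => hV.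
have mU : measurable U by exact: bigcup_measurable.
have mV : measurable V by exact: bigcup_measurable.
have : mu (B `\` V) <= mu (B `\` U) + mu (U `\` V).
  apply: muU_le; try exact: measurableD.
  by move=> x [[Bx nV] _]; have [Ux|nU] := pselect (U x); [right|left].
by lra.
Qed.

End ErgodicGdelta.

(** * The target property is a G_delta condition *)

Section TargetGdelta.
Context {R : realType}.
Local Notation I01 := (@I01 R).
Local Notation m := (@lebesgue_measure R).
Local Notation dyset := (@dyset R).
Local Notation address := (@address R).
Hint Resolve measurable_I01 measurable_dyset : core.

(** Points at exact distance [r], which dyadic inner approximations of the closed ball may miss;
    there are countably many. *)
Definition sphere (y r : R) : set R :=
  [set x | exists k : int, `|x - y - k%:~R| = r].

Lemma countable_sphere y r : countable (sphere y r).
Proof.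
have -> : sphere y r = \bigcup_(k : int) ([set x | `|x - y - k%:~R| = r]).
  by apply/seteqP; split=> x [k]; [exists k|move=> _ ?; exists k].
apply: bigcup_countable => // k _; apply: finite_set_countable.
apply: (@sub_finite_set _ _ [set y + k%:~R + r; y + k%:~R - r]).
  move=> x /= h; case: (ler0P (x - y - k%:~R)) h => _ h; [right|left] => /=; lra.
exact: finite_set2.
Qed.

Lemma measurable_sphere y r : measurable (sphere y r).
Proof.
by apply: countable_measurable (countable_sphere y r) => t; exact: measurable_set1.
Qed.

Lemma mu_sphere y r : mu (sphere y r) = 0.
Proof.
rewrite /mu countable_lebesgue_measure0//.
by apply: sub_countable (countable_sphere y r); apply: subset_card_le => x [].
Qed.

Variable eps : nat -> R.

(* Depends on finitely many dyadic data only, which makes [well_hit] weakly open. *)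
Definition inner_ball (n j i : nat) : set R :=
  dyset j (fun a => `[< forall x y, I01 x -> I01 y -> address j x = a ->
    address j y = i -> cball y (eps n) x >]).

(** [K] bounds the times and is also the rank of the cells, so one parameter exhausts the hits. *)
Definition inner_hits (tau : R -> R) (N K i : nat) : set R :=
  \bigcup_(n in [set n | (n < K)%N && (N <= n)%N])
    (iter n tau @^-1` (inner_ball n K i) `&` I01).

Definition good_centers (tau : R -> R) (N : nat) (c : R) (K : nat) : set R :=
  dyset K (fun i => c < mu (inner_hits tau N K i)).

Definition well_hit (N : nat) (c : R) (tau : R -> R) : Prop :=
  exists K, c < mu (good_centers tau N c K).

Lemma measurable_inner_ball n j i : measurable (inner_ball n j i).
Proof. exact: measurable_dyset. Qed.

Lemma measurable_inner_hits tau N K i : inM tau -> measurable (inner_hits tau N K i).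
Proof.
move=> tM; apply: bigcup_measurable => n _.
by have [] := inM_preimage (inM_iter n tM) (measurable_inner_ball n K i).
Qed.

(** With [K] fixed there are finitely many addresses of centres, and each strict inequality persists
    nearby, so no good centre is lost. *)
Lemma wnear_well_hit N c tau : inM tau -> well_hit N c tau -> wnear tau (well_hit N c).
Proof.
move=> tM [K hK].
have h i : (i < 2 ^ K)%N -> wnear tau (fun sigma =>
    c < mu (inner_hits tau N K i) -> c < mu (inner_hits sigma N K i)).
  move=> _; have [ci|ci] := ltP c (mu (inner_hits tau N K i)); last first.
    by apply: wnearT => sigma _.
  have d0 : 0 < mu (inner_hits tau N K i) - c by rewrite subr_gt0.
  apply: wnearS (wnear_fin (n := K) (P := fun n sigma =>
     mu (symdiff (iter n sigma @^-1` (inner_ball n K i) `&` I01)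
                 (iter n tau @^-1` (inner_ball n K i) `&` I01)) <
       (mu (inner_hits tau N K i) - c) / K.+1%:R) _); last first.
    move=> n _; apply: wnear_iter_preimage => //; first exact: measurable_inner_ball.
    by rewrite divr_gt0// ltr0n.
  move=> sigma sM hs _.
  have mt n : measurable (iter n tau @^-1` (inner_ball n K i) `&` I01).
    by have [] := inM_preimage (inM_iter n tM) (measurable_inner_ball n K i).
  have ms n : measurable (iter n sigma @^-1` (inner_ball n K i) `&` I01).
    by have [] := inM_preimage (inM_iter n sM) (measurable_inner_ball n K i).
  have := @mu_bigcup_close _ _ _ K (fun n => N <= n)%N _ d0 mt ms hs.
  rewrite -/(inner_hits tau N K i) -/(inner_hits sigma N K i) => h1.
  have m1 := measurable_inner_hits N K i tM.
  have m2 := measurable_inner_hits N K i sM.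
  have : mu (inner_hits tau N K i) <= mu (inner_hits sigma N K i) +
      mu (inner_hits tau N K i `\` inner_hits sigma N K i).
    apply: muU_le => //; first exact: measurableD.
    by move=> x [Vx _]; have [Sx|nS] := pselect (inner_hits sigma N K i x); [left|right].
  by lra.
apply: wnearS (wnear_fin h) => sigma sM hs; exists K; apply: lt_le_trans hK _.
apply: mu_mono; [exact: measurable_dyset..|].
by move=> x [[Ix cx] _]; split=> //; apply: hs => //; exact: address_lt.
Qed.

Lemma inner_hits_incr tau N K y :
  inner_hits tau N K (address K y) `<=` inner_hits tau N K.+1 (address K.+1 y).
Proof.
move=> x [n /= /andP[nK Nn] [[Inx /asboolP hx] Ix]].
exists n; first by rewrite /= ltnS ltnW.
split=> //; split=> //; apply/asboolP => x' y' Ix' Iy' ex ey.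
by apply: hx => //; exact: address_le_eq (leqnSn K) _.
Qed.

Lemma inner_hits_sub tau N K y : I01 y ->
  inner_hits tau N K (address K y) `<=` hit_union eps tau N y.
Proof.
move=> Iy x [n /= /andP[_ Nn] [[Inx /asboolP hx] Ix]].
by exists n => //; split=> //; exact: hx.
Qed.

Lemma hit_union_inner tau N y x : I01 y -> inM tau -> hit_union eps tau N y x ->
  (forall n, ~ sphere y (eps n) (iter n tau x)) ->
  exists K, inner_hits tau N K (address K y) x.
Proof.
move=> Iy tM [n /= Nn [[Inx [k hk]] Ix]] nS.
have hk' : `|iter n tau x - y - k%:~R| < eps n.
  by rewrite lt_neqAle hk andbT; apply/eqP => e; apply: (nS n); exists k.
(* Half of the slack, since the iterate and the centre may both move within their cells. *)
have d0 : 0 < (eps n - `|iter n tau x - y - k%:~R|) / 2.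
  by rewrite divr_gt0// subr_gt0.
have [j hj] := exp2_small d0.
exists (maxn n.+1 j), n; first by rewrite /= leq_maxl Nn.
split=> //; split=> //; apply/asboolP => x' y' Ix' Iy' ex ey.
split=> //; exists k.
have hx := address_dist Ix' Inx ex; have hy := address_dist Iy Iy' (esym ey).
have := exp2V_le (leq_maxr n.+1 j) : (2 ^+ _)^-1 <= (2 ^+ _)^-1 :> R.
move: hx hy; set K := maxn _ _; move: ((2 ^+ K)^-1) ((2 ^+ j)^-1) hj => a b hj hx hy hab.
have -> : x' - y' - k%:~R = (x' - iter n tau x) + (y - y') + (iter n tau x - y - k%:~R).
  by ring.
have h1 := ler_normD (x' - iter n tau x + (y - y')) (iter n tau x - y - k%:~R).
have h2 := ler_normD (x' - iter n tau x) (y - y').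
by lra.
Qed.

Lemma good_centers_incr tau N c K : inM tau ->
  good_centers tau N c K `<=` good_centers tau N c K.+1.
Proof.
move=> tM y [Iy cy]; split=> //; apply: lt_le_trans cy _; apply: mu_mono.
- exact: measurable_inner_hits.
- exact: measurable_inner_hits.
- by move=> x [h _]; exact: inner_hits_incr.
Qed.

(** [mu_up] is used twice: for almost every centre the inner hits increase to full measure, hence so
    do the good centres. *)
Lemma shrinking_target_well_hit tau N c : inM tau -> shrinking_target_full eps tau ->
  (1 <= N)%N -> c < 1 -> well_hit N c tau.
Proof.
move=> tM [Z [mZ [Z0 h]]] N1 c1.
have mG K : measurable (good_centers tau N c K) by exact: measurable_dyset.
apply: (mu_up mG) => [K|]; first exact: good_centers_incr.
apply: (lt_le_trans c1); rewrite -mu_I01.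
have muZ : mu Z = 0.
  apply/eqP; rewrite eq_le mu_ge0 andbT -lee_fin -m_mu//.
  apply: (@le_trans _ _ (m Z)); last by rewrite Z0.
  apply: le_measure; rewrite ?inE//; exact: measurableI mZ measurable_I01.
have mGG : measurable (\bigcup_K good_centers tau N c K) by exact: bigcupT_measurable.
rewrite -[leRHS]addr0 -muZ; apply: muU_le => // y [Iy _].
have [Zy|nZy] := pselect (Z y); [by right|left].
have y01 : `[0, 1]%classic y.
  by move/I01P: Iy => /andP[y0 y1]; rewrite /= in_itv /= y0 ltW.
have hy := h y y01 nZy N N1; rewrite -/(hit_union eps tau N y) in hy.
pose V K := inner_hits tau N K (address K y).
have mV K : measurable (V K) by exact: measurable_inner_hits.
have mH := measurable_hit_union eps N y tM.
have H1 : mu (hit_union eps tau N y) = 1.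
  by apply: EFin_inj; rewrite -m_muS//; exact: hit_union_I01.
have mS n := inM_preimage (inM_iter n tM) (measurable_sphere y (eps n)).
have mUV : measurable (\bigcup_K V K) by exact: bigcupT_measurable.
have [||K hK] := @mu_up _ V c mV.
- by move=> K; exact: inner_hits_incr.
- apply: lt_le_trans c1 _; rewrite -H1.
  pose S := \bigcup_n (iter n tau @^-1` sphere y (eps n) `&` I01).
  have mSS : measurable S by apply: bigcupT_measurable => n; case: (mS n).
  have S0 : mu S = 0.
    apply: mu0_bigcup => n; first by case: (mS n).
    by rewrite (mS n).2 mu_sphere.
  rewrite -[leRHS]addr0 -S0; apply: muU_le => // x [hx Ix].
  have [Sx|nS] := pselect (S x); [by right|left].
  have [|K hK] := hit_union_inner Iy tM hx; last by exists K.
  by move=> n sn; apply: nS; exists n.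
- by exists K.
Qed.

Definition level (q : nat) : R := 1 - q.+1%:R^-1.

Lemma level_lt1 q : level q < 1.
Proof. by rewrite /level gtrBl invr_gt0 ltr0n. Qed.

Lemma level_le q p : (q <= p)%N -> level q <= level p.
Proof. by move=> qp; rewrite lerD2l lerN2 lef_pV2 ?posrE ?ltr0n// ler_nat. Qed.

Lemma level_ge1 (x : R) : (forall q, level q < x) -> 1 <= x.
Proof.
move=> h; rewrite leNgt; apply/negP => x1.
have d0 : 0 < 1 - x by rewrite subr_gt0.
have [q _ /(_ q (leqnn _)) hq0] := near_infty_natSinv_lt (PosNum d0).
have hq : q.+1%:R^-1 < 1 - x := hq0.
have := h q; rewrite /level ltrBlDr -ltrBlDl => h'.
by have := lt_trans h' hq; rewrite ltxx.
Qed.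

(** For each [N] and [q] almost every centre is eventually good; the countably many exceptional null
    sets, together with the point 1, form [Z]. *)
Lemma well_hit_shrinking_target tau : inM tau ->
  (forall N q, well_hit N.+1 (level q) tau) -> shrinking_target_full eps tau.
Proof.
move=> tM wh.
have mG N q K : measurable (good_centers tau N.+1 (level q) K).
  exact: measurable_dyset.
pose Y N q := \bigcup_K good_centers tau N.+1 (level q) K.
have mY N q : measurable (Y N q) by exact: bigcupT_measurable.
have mIY N q : measurable (I01 `\` Y N q) by exact: measurableD measurable_I01 (mY N q).
have Yq N q p : (q <= p)%N -> Y N p `<=` Y N q.
  move=> qp y [K _ [Iy cy]]; exists K => //; split=> //.
  exact: le_lt_trans (level_le qp) cy.
have Y1 N q : mu (Y N q) = 1.
  (* [well_hit] uses one level for the centres and for the hits; a level above both [p] and [q]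
     separates the two uses. *)
  apply/eqP; rewrite eq_le mu_le1//=; apply: level_ge1 => p.
  have [K hK] := wh N (maxn q p).
  apply: (@le_lt_trans _ _ (level (maxn q p))); first exact/level_le/leq_maxr.
  apply: lt_le_trans hK _; apply: mu_mono => // y [h _].
  by apply: (Yq N q _ (leq_maxl q p)); exists K.
have IY0 N q : mu (I01 `\` Y N q) = 0.
  by have := muDI measurable_I01 (mY N q); rewrite mu_I01 setIC muI_I01 Y1; lra.
pose Z0 := \bigcup_N \bigcup_q (I01 `\` Y N q).
have mZ0 : measurable Z0.
  by apply: bigcupT_measurable => N; exact: bigcupT_measurable.
have muZ0 : m Z0 = 0%E.
  rewrite m_muS//; last by move=> x [N _ [q _ []]].
  congr EFin; apply: mu0_bigcup => N; first exact: bigcupT_measurable.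
  by apply: mu0_bigcup.
exists (Z0 `|` [set 1]); split; first by apply: measurableU => //; exact: measurable_set1.
split.
  apply/eqP; rewrite eq_le measure_ge0 andbT.
  have m1 : measurable [set (1 : R)] by exact: measurable_set1.
  have h2 : (m (Z0 `|` [set 1%R : R]) <= m Z0 + m [set 1%R : R])%E by exact: measureU2.
  by apply: le_trans h2 _; rewrite muZ0 lebesgue_measure_set1 adde0.
move=> y /=; rewrite in_itv /= => /andP[y0 y1] nZy [//|N] _.
have Iy : I01 y.
  by rewrite I01P y0 lt_neqAle y1 andbT; apply/eqP => e; apply: nZy; right.
rewrite -/(hit_union eps tau N.+1 y).
apply: m_eq1; [exact: measurable_hit_union|exact: hit_union_I01|].
apply: level_ge1 => q.
have [K _ [_ hK]] : Y N q y.
  apply: contrapT => nY; apply: nZy; left; exists N => //; exists q => //.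
apply: lt_le_trans hK _; apply: mu_mono.
- exact: measurable_inner_hits.
- exact: measurable_hit_union.
- by move=> x [h _]; exact: inner_hits_sub h.
Qed.

(** Listing the addresses of a dyadic set as a finite sequence makes the family of open conditions
    countable. *)
Lemma Rset_Gdelta : weak_Gdelta (Rset eps).
Proof.
pose good (t : nat * seq nat * nat * nat) : set (R -> R) :=
  let: (r, s, q, N) := t in
  [set tau | inM tau /\ transports r (mem s) q.+1%:R^-1 tau /\
             well_hit N.+1 (level q) tau].
(* Numbers that code no condition contribute all of [inM], which is weakly open. *)
pose U n : set (R -> R) := if unpickle n is Some t then good t else inM (R := R).
exists U; split.
  move=> n; rewrite /U; case: unpickle => [[[[r s] q] N]|]; last first.
    by apply: wnear_open => // tau tM; exact: wnearT.
  apply: wnear_open => [tau []//|tau [tM [h1 h2]]].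
  apply: wnearS (wnearI (wnear_transports tM h1) (wnear_well_hit tM h2)).
  by move=> sigma sM [].
apply/seteqP; split=> [tau [tM [erg st]] n _|tau h].
  rewrite /U; case: unpickle => [[[[r s] q] N]|] //.
  split=> //; split; first by apply: ergodic_transports => //; rewrite invr_gt0 ltr0n.
  by apply: shrinking_target_well_hit => //; exact: level_lt1.
have hg t : good t tau by have := h (pickle t) Logic.I; rewrite /U pickleK.
have tM : inM tau by have [] := hg (0%N, [::], 0%N, 0%N).
split=> //; split.
- apply: transports_ergodic => // r P q.
  (* Addresses of rank [r] are below [2 ^ r], so an arbitrary [P] can be replaced by a finite
     list. *)
  have [_ [ht _]] := hg (r, [seq i <- iota 0 (2 ^ r) | P i], q, 0%N).
  rewrite /transports; have -> // : dyset r P =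
      dyset r (mem [seq i <- iota 0 (2 ^ r) | P i]).
  apply/seteqP; split=> x [Ix Px]; split=> //.
    by rewrite /= mem_filter Px mem_iota address_lt.
  by move: Px; rewrite /= mem_filter => /andP[].
- apply: well_hit_shrinking_target => // N q.
  by have [_ []] := hg (0%N, [::], q, N).
Qed.

End TargetGdelta.

Unset Implicit Arguments.

Theorem mainTheorem2 (R : realType) (eps : nat -> R)
  (eps_pos : forall n, (1 <= n)%N -> 0 < eps n)
  (eps_decr : forall n p, (1 <= n)%N -> (n <= p)%N -> eps p <= eps n)
  (eps_div : (fun n => \sum_(1 <= k < n) eps k) @ \oo --> +oo) :
  weak_dense (Rset eps) /\ weak_Gdelta (Rset eps).
Proof.
by split; [exact: Rset_dense|exact: Rset_Gdelta].
Qed.
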